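(* Let $\mathcal{S}$ be the Brownian stable web. With probability one, for every aged path $(\gamma,a)\in\mathcal{S}$, with domain $(\sigma,\infty)$, the limit $\lim_{s\downarrow\sigma}\gamma(s)$ exists (in $\mathbb{R}$); that is, $(\gamma,a)$ can be extended continuously to $[\sigma,\infty)$.
   Context: Aged paths. An aged path is a pair $(\gamma,a)$ of real-valued càdlàg functions defined on an open interval $(\sigma,\infty)$ ($\sigma\in\mathbb{R}$ is the birth time) such that (i) $\lim_{s\downarrow\sigma}a(s)=0$; (ii) $a(t+s)-a(s)\ge t$ for all $t>0$, $s>\sigma$; (iii) $\gamma$ and $a$ never jump at the same time. Brownian stable web. Let $(x_i,t_i)_{i\ge1}$ enumerate the space-time points of $\mathbb{R}^2$ with dyadic rational coordinates, and let $(B^i(s))_{s\ge t_i}$, $i\ge1$, be a system of coalescing one-dimensional Brownian motions with $B^i(t_i)=x_i$: the motions evolve independently until they meet, and after meeting they coincide (recursively, $B^i$ follows an independent Brownian motion until it first meets some $B^j$ with $j<i$, and follows $B^j$ thereafter). The age of $B^i$ is $a^i(s)=\sup\{s-t_j:\ t_j\le s,\ B^j(s)=B^i(s)\}$, $s\ge t_i$. The Brownian stable web $\mathcal{S}$ (the stable web for $\alpha=2$) is the random collection of all aged paths $(\gamma,a)$, with birth time $\sigma$, such that for every $s>\sigma$ there is $i$ with $t_i\le s$ and $(\gamma,a)=(B^i,a^i)$ on $[s,\infty)$. *)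

(* Defs.v *)
From HB Require Import structures.
From mathcomp Require Import all_boot all_order all_algebra.
From mathcomp Require Import all_classical all_reals all_analysis.

Set Implicit Arguments.
Unset Strict Implicit.
Unset Printing Implicit Defensive.

Import Order.TTheory GRing.Theory Num.Theory.
Import numFieldNormedType.Exports.

Local Open Scope classical_set_scope.
Local Open Scope ring_scope.

Section independence.
Context d (T : measurableType d) (R : realType) (P : probability T R).

Definition mutually_independent (I : choiceType) (F : I -> set (set T)) : Prop :=
  forall (J : seq I) (E : I -> set T), uniq J ->
    (forall i, i \in J -> F i (E i)) ->
    P (\bigcap_(i in [set` J]) E i) = (\prod_(i <- J) P (E i))%E.

Definition sigma_of (X : T -> R) : set (set T) :=
  preimage_set_system setT X measurable.

Definition sigma_of_process (X : R -> T -> R) : set (set T) :=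
  <<s \bigcup_(t in `[0, +oo[) sigma_of (X t) >>.

End independence.

Section brownian.
Context d (T : measurableType d) (R : realType) (P : probability T R).

(* Only the values W t with 0 <= t matter. The variance-0 case is left out of
   the Gaussian clause because normal_prob 0 0 is not a Dirac mass. *)
Definition brownian_motion (W : R -> {RV P >-> R}) : Prop :=
  [/\ {ae P, forall w, W 0 w = 0},
      forall s t, 0 <= s -> s < t -> forall A : set R, measurable A ->
        P ((fun w => W t w - W s w) @^-1` A) =
        normal_prob 0 (Num.sqrt (t - s)) A,
      forall u : nat -> R, 0 <= u 0%N -> {homo u : m n / (m <= n)%N >-> m <= n} ->
        mutually_independent P
          (fun k => sigma_of (fun w => W (u k.+1) w - W (u k) w))
    & {ae P, forall w, {within `[0, +oo[, continuous (fun t => W t w)}}].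

Definition independent_brownian_motions (W : nat -> R -> {RV P >-> R}) : Prop :=
  (forall i, brownian_motion (W i)) /\
  mutually_independent P (fun i => sigma_of_process (fun t => W i t : T -> R)).

End brownian.

Section coalescing_paths.
Context (R : realType).
Implicit Types (pt : nat -> R * R) (W B : nat -> R -> R).

Definition dyadic : set R := [set x | exists (m : int) (n : nat), x = m%:~R / 2 ^+ n].

Definition dyadic_enumeration pt : Prop :=
  set_bij setT (dyadic `*` dyadic) pt.

Definition driving_path pt W i (s : R) : R := (pt i).1 + W i (s - (pt i).2).

Definition meets pt W B i j (s : R) : Prop :=
  [/\ (j < i)%N, (pt i).2 <= s, (pt j).2 <= s & driving_path pt W i s = B j s].

(* B i is only meaningful on [(pt i).2, +oo[; it agrees with its driving path
   strictly before the first meeting time u, and with the path met at u from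
   time u on. *)
Definition coalescing_system pt W B : Prop :=
  forall i s, (pt i).2 <= s ->
    ((forall j u, u <= s -> ~ meets pt W B i j u) ->
       B i s = driving_path pt W i s) /\
    (forall j u, u <= s -> meets pt W B i j u ->
       (forall k v, v < u -> ~ meets pt W B i k v) ->
       B i s = B j s).

(* The supremum is taken in the extended reals, so that it is never a junk
   value. *)
Definition skeleton_age pt B i (s : R) : \bar R :=
  ereal_sup [set (s - (pt j).2)%:E | j in [set j | (pt j).2 <= s /\ B j s = B i s]].

End coalescing_paths.

Section web.
Context (R : realType).
Implicit Types (sigma : R) (g a : R -> R).

Definition cadlag sigma g : Prop := forall s, sigma < s ->
  g x @[x --> s^'+] --> g s /\ cvg (g x @[x --> s^'-]).

Definition jumps_at g (s : R) : Prop := ~ (g x @[x --> s^'-] --> g s).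

(* A path with domain ]sigma, +oo[ is represented by any total function with
   the right values there. *)
Definition aged_path sigma g a : Prop :=
  [/\ cadlag sigma g /\ cadlag sigma a,
      a x @[x --> sigma^'+] --> (0 : R),
      forall t s, 0 < t -> sigma < s -> t <= a (t + s) - a s
    & forall s, sigma < s -> ~ (jumps_at g s /\ jumps_at a s)].

Definition stable_web (pt : nat -> R * R) (B : nat -> R -> R) sigma g a : Prop :=
  aged_path sigma g a /\
  forall s, sigma < s -> exists i, (pt i).2 <= s /\
    forall u, s <= u -> g u = B i u /\ (a u)%:E = skeleton_age pt B i u.

Definition extends_continuously sigma g : Prop :=
  exists h : R -> R, (forall s, sigma < s -> h s = g s) /\
    h x @[x --> sigma^'+] --> h sigma.

End web.

(* Main.v *)
Require Import Defs.
From HB Require Import structures.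
From mathcomp Require Import all_boot all_order all_algebra.
From mathcomp Require Import all_classical all_reals all_analysis.
From mathcomp Require Import measurable_realfun.
From mathcomp Require Import ring lra zify.
Set Implicit Arguments.
Unset Strict Implicit.
Unset Printing Implicit Defensive.

Import Order.TTheory GRing.Theory Num.Theory.
Import numFieldNormedType.Exports.
Local Open Scope classical_set_scope.
Local Open Scope ring_scope.

(** A path of the web is, from any time after its birth on, a path of the skeleton,
    and skeleton paths cannot cross: two of them that exchange their order have met,
    and coincide from then on ([noncrossing]). A skeleton path that moves little is
    therefore a barrier for every web path. Two families of barriers force a web path
    to converge at its birth time ([trapped_cvg]).

    The path is bounded near its birth: from every integer time [q], almost surely
    infinitely many of the paths started at the points [(j, q)], for positive as well
    as for negative [j], stay within [`|j| / 2] of their start for two units of time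
    ([caged_ae]), and a path coming from infinity would cross one of them.

    It oscillates little: for every [delta = 2 ^- m] there is almost surely a time scale
    [e] at which all the paths started in a bounded part of a grid of mesh [delta] in
    space and [e] in time move by at most [delta] during a time [2 * e] ([calm_ae]). Caught
    between two of them, the web path moves by at most [3 * delta] during a time [e].
    This is the Cauchy criterion. As for the age, it tends to [0] by definition.

    Both families come from one estimate ([escape_small]): a skeleton path moves by more
    than [delta] within a time [tau] with probability at most
    [2 * exp (- delta ^ 2 / (8 * tau))], which beats the number of grid points, of order
    [1 / tau]. It would follow from the reflection principle if the coalesced path were
    known to be a Brownian motion, a fact that needs the strong Markov property. Instead,
    the path is compared with a walk in discrete time that follows, on each step of a
    mesh, the driving motion of the current leader, that is of the live path with which
    the given path has merged. Leaders have decreasing indices, so that the walk is wrong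
    on a bounded number of steps, and the error vanishes with the mesh
    ([leader_walk_approx]). The leader depends on the past only ([measurable_leader]), the
    next increments of the driving motions are independent of the past
    ([future_independent]), and hence the exponential of the walk satisfies the usual
    maximal inequality ([chosen_walk_maximal]). *)

(** * Coalescing paths for one fixed realisation *)

Section closed_sets.
Context {R : realType}.

Lemma closed_coincidence (f g : R -> R) :
  continuous f -> continuous g -> closed [set u | f u = g u].
Proof.
move=> cf cg.
have -> : [set u | f u = g u] = (f \- g) @^-1` [set 0].
  apply/seteqP; split => u /=; first by move=> ->; rewrite subrr.
  by move/subr0_eq.
apply: preimage_closed; last exact: closed_eq.
by move=> u _; apply: continuousB; [exact: cf|exact: cg].
Qed.

Lemma closed_min (S : set R) : closed S -> has_lbound S -> S !=set0 ->
  exists2 m, S m & lbound S m.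
Proof.
move=> cS lbS S0; exists (inf S); last exact: ge_inf.
have : closure (-%R @` S) (sup (-%R @` S)).
  by apply: closure_sup; [apply/nonemptyN|apply/has_lb_ubN].
have cNS : closed (-%R @` S).
  rewrite (_ : -%R @` S = -%R @^-1` S).
    by apply: preimage_closed => // x _; exact: (@opp_continuous R).
  apply/seteqP; split => x /=; first by move=> [y Sy <-]; rewrite opprK.
  by move=> Sx; exists (- x) => //; rewrite opprK.
move: cNS => /closure_id <- [y Sy].
by rewrite /inf => <-; rewrite opprK.
Qed.

End closed_sets.

Section deterministic.
Context (R : realType) (pt : nat -> R * R) (W B : nat -> R -> R).
Hypothesis Wc : forall i, continuous (W i).
Hypothesis W0 : forall i, W i 0 = 0.
Hypothesis HB : coalescing_system pt W B.

Local Notation pos i := (pt i).1.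
Local Notation start i := (pt i).2.
Local Notation drive := (driving_path pt W).
Local Notation meeting := (Defs.meets pt W B).

Definition first_meeting i j (s : R) : Prop :=
  meeting i j s /\ forall k v, v < s -> ~ meeting i k v.

(** The path frozen before its start, so that continuity makes sense on the
    whole line. *)
Definition extended_path i (s : R) : R := B i (Num.max s (start i)).

Lemma extended_pathE i s : start i <= s -> extended_path i s = B i s.
Proof. by move=> h; rewrite /extended_path max_l. Qed.

Lemma drive_continuous i : continuous (drive i).
Proof.
move=> s; apply: cvgD; first exact: cvg_cst.
apply: (cvg_comp (fun x => x - start i)); last exact: Wc.
by apply: cvgB; [exact: cvg_id|exact: cvg_cst].
Qed.

Lemma drive_start i : drive i (start i) = pos i.
Proof. by rewrite /driving_path subrr W0 addr0. Qed.

Lemma eq_drive i s : start i <= s -> (forall j u, u <= s -> ~ meeting i j u) ->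
  B i s = drive i s.
Proof. by move=> h; exact: (HB h).1. Qed.

Lemma first_meeting_follow i j u s : first_meeting i j u -> u <= s ->
  B i s = B j s.
Proof.
move=> [m f] us; have [_ iu _ _] := m.
exact: (HB (le_trans iu us)).2 us m f.
Qed.

Lemma closed_meeting i j : continuous (extended_path j) ->
  closed [set u | meeting i j u].
Proof.
move=> cj; have [ji|ij] := ltnP j i; last first.
  rewrite (_ : [set u | _] = set0); first exact: closed0.
  by apply/seteqP; split=> u //= -[]; rewrite ltnNge ij.
rewrite (_ : [set v | _] = [set v | start i <= v] `&` ([set v | start j <= v]
    `&` [set v | drive i v = extended_path j v])); last first.
  apply/seteqP; split=> v /= => [[_ h1 h2 h3]|[h1 [h2 h3]]].
    by rewrite extended_pathE.
  by split=> //; rewrite h3 extended_pathE.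
apply: closedI; first exact: closed_ge.
apply: closedI; first exact: closed_ge.
exact: closed_coincidence (@drive_continuous i) cj.
Qed.

Lemma exists_first_meeting_from i j u :
  (forall k, (k < i)%N -> continuous (extended_path k)) ->
  meeting i j u -> exists k s, s <= u /\ first_meeting i k s.
Proof.
move=> ck mu.
pose S := \bigcup_(k in `I_i) [set v | meeting i k v].
have [||| s [k ki mk] sS] := @closed_min R S.
- by apply: closed_bigcup => [|k ki]; [exact: finite_II|exact/closed_meeting/ck].
- by exists (start i) => v [k _ []].
- by have [ji _ _ _] := mu; exists u, j.
exists k, s; split; first by have [ji _ _ _] := mu; apply: sS; exists j.
split=> // l v vs mv; have [li _ _ _] := mv.
have : s <= v by apply: sS; exists l.
by rewrite leNgt vs.
Qed.

(** A path is its driving path stopped at the first meeting, plus the increment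
    of the path met from that time on; written that way, with minima and maxima
    of times, continuity needs no gluing. *)
Lemma extended_path_continuous i : continuous (extended_path i).
Proof.
have cmax a : continuous (fun s : R => Num.max s a).
  by move=> s; apply: continuous_max; [exact: cvg_id|exact: cvg_cst].
have cmin a : continuous (fun s : R => Num.min s a).
  by move=> s; apply: continuous_min; [exact: cvg_id|exact: cvg_cst].
have ccomp (f g : R -> R) : continuous f -> continuous g -> continuous (g \o f).
  by move=> cf cg s; apply: continuous_comp; [exact: cf|exact: cg].
elim/ltn_ind: i => i IH.
have [[j [u mu]]|nomeet] := pselect (exists j u, meeting i j u); last first.
  suff -> : extended_path i = drive i \o (fun s => Num.max s (start i)).
    by apply: (@ccomp) => //; exact: drive_continuous.
  apply/funext => s; apply: eq_drive; first by rewrite le_max lexx orbT.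
  by move=> j u _ mu; apply: nomeet; exists j, u.
have [k [s [_ fm]]] := exists_first_meeting_from IH mu.
have [[ki si sk ms] fs] := fm.
suff -> : extended_path i = (fun v => (drive i \o ((fun v => Num.max v (start i))
    \o (fun v => Num.min v s))) v
    + ((extended_path k \o (fun v => Num.max v s)) v - B k s)).
  move=> v; apply: continuousD.
    by apply: (@ccomp); [exact: (@ccomp)|exact: drive_continuous].
  apply: continuousB; last exact: cvg_cst.
  by apply: (@ccomp) => //; exact: IH.
apply/funext => v /=.
have [vs|sv] := ltP v s.
  rewrite (extended_pathE sk) subrr addr0 /extended_path.
  have [ws|sw] := ltP (Num.max v (start i)) s.
    apply: eq_drive; first by rewrite le_max lexx orbT.
    by move=> l w wv; apply: fs; exact: le_lt_trans wv ws.
  have -> : Num.max v (start i) = s.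
    by apply/eqP; rewrite eq_le sw andbT ge_max (ltW vs).
  by rewrite (first_meeting_follow fm) ?ms.
rewrite (max_l si) ms.
rewrite (@extended_pathE k _ (le_trans sk sv)) extended_pathE ?(le_trans si)//.
by rewrite addrC subrK (first_meeting_follow fm).
Qed.

Lemma exists_first_meeting i j u : meeting i j u ->
  exists k s, s <= u /\ first_meeting i k s.
Proof.
by apply: exists_first_meeting_from => k _; exact: extended_path_continuous.
Qed.

Lemma exists_first_meeting_with i j u : meeting i j u ->
  exists s, [/\ s <= u, meeting i j s & forall v, v < s -> ~ meeting i j v].
Proof.
move=> mu; have [||| s ms sS] := @closed_min R [set v | meeting i j v].
- exact/closed_meeting/extended_path_continuous.
- by exists (start i) => v [].
- by exists u.
exists s; split=> // [|v vs mv]; first exact: sS.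
by have := sS v mv; rewrite leNgt vs.
Qed.

Lemma start_value i : B i (start i) = pos i.
Proof.
have [[j [u [uu mu]]]|nm] := pselect (exists j u, u <= start i /\ meeting i j u).
  have [k [s [su fm]]] := exists_first_meeting mu.
  have si : s <= start i by exact: le_trans uu.
  have [[_ ist _ e] _] := fm.
  have es : s = start i by apply/eqP; rewrite eq_le si.
  by rewrite (first_meeting_follow fm si) -es -e es drive_start.
rewrite eq_drive ?drive_start// => j u uu mu.
by apply: (nm); exists j, u.
Qed.

(** Of two paths found at the same place, the one of larger index has already
    been absorbed, since otherwise this is a meeting; induction applies to the
    path that it follows. *)
Lemma coalesce i j s u : start i <= s -> start j <= s -> B i s = B j s ->
  s <= u -> B i u = B j u.
Proof.
suff main n : forall i j s u, (i < n)%N -> (j < i)%N -> start i <= s ->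
    start j <= s -> B i s = B j s -> s <= u -> B i u = B j u.
  move=> hi hj e su; case: (ltngtP i j) => [ij|ji|->//].
  - by apply/esym; apply: (main j.+1 j i s).
  - by apply: (main i.+1 i j s).
elim: n => // n IH {}i {}j {}s {}u.
rewrite ltnS => iN ji hi hj e su.
have [[k [v [vs mv]]]|nm] := pselect (exists k v, v <= s /\ meeting i k v);
    last first.
  exfalso; apply: (nm); exists j, s; split=> //; split=> //.
  rewrite -e; apply/esym/eq_drive => // k v vs mv.
  by apply: (nm); exists k, v.
have [l [w [wv fm]]] := exists_first_meeting mv.
have [[li iw lw _] _] := fm.
have ws := le_trans wv vs.
rewrite (first_meeting_follow fm (le_trans ws su)).
move: e; rewrite (first_meeting_follow fm ws) => e.
have hl := le_trans lw ws.
case: (ltngtP l j) => [lj|jl|->//].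
- by apply/esym; apply: (IH j l s) => //; exact: leq_trans iN.
- by apply: (IH l j s) => //; exact: leq_trans iN.
Qed.

(** Coalescence turns the intermediate value theorem into a comparison
    principle: two paths exchanging their order would have met before. *)
Lemma noncrossing i j s u : start i <= s -> start j <= s -> B i s <= B j s ->
  s <= u -> B i u <= B j u.
Proof.
move=> hi hj h su; rewrite leNgt; apply/negP => hlt.
pose f v := extended_path i v - extended_path j v.
have cf : continuous f.
  by move=> v; apply: cvgB; exact: extended_path_continuous.
have [||v] := @IVT R f s u 0 su.
- by apply: continuous_subspaceT => v; exact: cf.
- rewrite /f !extended_pathE ?(le_trans _ su)//.
  by rewrite min_l ?max_r ?subr_le0 ?subr_ge0 ?h ?ltW//; lra.
move=> /[!in_itv]/= /andP[sv vu]; rewrite /f !extended_pathE ?(le_trans _ sv)//.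
move/subr0_eq => e.
have := coalesce (le_trans hi sv) (le_trans hj sv) e vu.
by move=> eu; rewrite eu ltxx in hlt.
Qed.

Definition alive j s : Prop := forall k v, v <= s -> ~ meeting j k v.

Lemma aliveE j s u : alive j u -> start j <= s -> s <= u -> B j s = drive j s.
Proof.
by move=> a js su; apply: eq_drive => // k v vs; apply: a; exact: le_trans su.
Qed.

(** The live path with which the path [i] has merged by time [s]: its driving
    path is the one that [i] is following. *)
Definition leads i s j : Prop :=
  [/\ (j <= i)%N, start j <= s, alive j s & B j s = B i s].

Lemma leads_exists i s : start i <= s -> exists j, leads i s j.
Proof.
elim/ltn_ind: i => i IH si.
have [a|na] := pselect (alive i s); first by exists i.
have [k [v [vs mv]]] : exists k v, v <= s /\ meeting i k v.
  apply: contrapT => nm; apply: na => k v vs mv; apply: (nm).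
  by exists k, v.
have [l [w [wv fm]]] := exists_first_meeting mv.
have [[li iw lw _] _] := fm.
have ws := le_trans wv vs.
have [j [jl js aj ej]] := IH l li (le_trans lw ws).
exists j; split => //; first exact: leq_trans jl (ltnW li).
by rewrite ej (first_meeting_follow fm ws).
Qed.

(** Two live paths at the same place are meeting, which kills one of them. *)
Lemma leads_unique i s j k : leads i s j -> leads i s k -> j = k.
Proof.
suff main l m : (l < m)%N -> leads i s l -> leads i s m -> False.
  move=> hj hk; case: (ltngtP j k) => // [jk|kj].
  - by have := main _ _ jk hj hk.
  - by have := main _ _ kj hk hj.
move=> lm [_ ls al el] [_ ms am em].
apply: (am l s (lexx s)); split => //.
by rewrite -(aliveE am) ?em ?el.
Qed.

Definition leader i s : nat := xget 0%N [set j | leads i s j].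

Lemma leaderP i s : start i <= s -> leads i s (leader i s).
Proof. by move=> /leads_exists[j hj]; rewrite /leader; case: xgetP => [//|/(_ j)]. Qed.

Lemma leader_leq i s : start i <= s -> (leader i s <= i)%N.
Proof. by move=> /leaderP[]. Qed.

Lemma leader_unique i s j : leads i s j -> leader i s = j.
Proof.
move=> hj; rewrite /leader; case: xgetP => [k _ hk|/(_ j)//].
exact: leads_unique hk hj.
Qed.

Lemma leader_nonincreasing i s u : start i <= s -> s <= u ->
  (leader i u <= leader i s)%N.
Proof.
move=> si su; have [ji js aj ej] := leaderP si.
have [kj ku ak ek] := leaderP (le_trans js su).
rewrite (@leader_unique i u (leader (leader i s) u))//.
split => //; first exact: leq_trans ji.
by rewrite ek; exact: (coalesce js si ej su).
Qed.

Lemma leader_drive i s u : start i <= s -> s <= u -> leader i u = leader i s ->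
  B i u - B i s = drive (leader i s) u - drive (leader i s) s.
Proof.
move=> si su eL; have [ji js aj ej] := leaderP si.
have [_ _ au eu] := leaderP (le_trans si su).
rewrite eL in eu au.
by rewrite -ej -eu !(aliveE au)//; exact: le_trans su.
Qed.

(** Each step is selected at the time when it begins, so that the walk is
    predictable once the leaders are known to be adapted. *)
Fixpoint leader_walk i (r : nat -> R) n : R :=
  if n is m.+1 then leader_walk i r m +
    (drive (leader i (r m)) (r m.+1) - drive (leader i (r m)) (r m))
  else 0.

(** Since the leader can only decrease, it changes at most [i] times along a
    subdivision; only the steps where it changes contribute to the error. *)
Lemma leader_walk_approx i (r : nat -> R) n (e : R) : 0 <= e -> start i <= r 0%N ->
  {homo r : m k / (m <= k)%N >-> m <= k} ->
  (forall m, (m < n)%N -> `|B i (r m.+1) - B i (r m)| <= e) ->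
  (forall m j, (m < n)%N -> (j <= i)%N ->
     `|drive j (r m.+1) - drive j (r m)| <= e) ->
  `|B i (r n) - B i (r 0%N) - leader_walk i r n| <= e *+ (2 * i).
Proof.
move=> e0 i0 hr hB hd.
have ir m : start i <= r m by apply: le_trans i0 _; exact: hr.
have main k : (k <= n)%N -> `|B i (r k) - B i (r 0%N) - leader_walk i r k| <=
    e *+ (2 * (i - leader i (r k))).
  elim: k => [_|k IH kn]; first by rewrite /= subrr subr0 normr0 mulrn_wge0.
  set L := leader i (r k); set L' := leader i (r k.+1).
  have rk : r k <= r k.+1 by exact: hr.
  have LL' : (L' <= L)%N by exact: leader_nonincreasing.
  have Li : (L <= i)%N by exact: leader_leq.
  rewrite (_ : _ - leader_walk i r k.+1 =
    (B i (r k) - B i (r 0%N) - leader_walk i r k) +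
    ((B i (r k.+1) - B i (r k)) - (drive L (r k.+1) - drive L (r k)))); last first.
    by rewrite /= -/L; ring.
  apply: le_trans (ler_normD _ _) _.
  have [eL|nL] := eqVneq L' L.
    by rewrite (leader_drive _ _ eL)// subrr normr0 addr0 eL IH// ltnW.
  have -> : (2 * (i - L') = 2 * (i - L) + (2 * (L - L').-1 + 2))%N.
    by move: LL'; rewrite leq_eqVlt (negbTE nL) /=; lia.
  rewrite mulrnDr; apply: lerD; first by rewrite IH// ltnW.
  rewrite mulrnDr; apply: ler_wpDl; first by rewrite mulrn_wge0.
  apply: le_trans (ler_normB _ _) _; rewrite mulr2n.
  by apply: lerD; [exact: hB|exact: hd].
apply: le_trans (main n (leqnn n)) _; rewrite ler_wpMn2l //.
by rewrite leq_mul2l leq_subr.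
Qed.

End deterministic.

(** * Gaussian exponential moments *)

Section gaussian.
Context {R : realType}.
Local Notation mu := (@lebesgue_measure R).

Lemma ge0_integral_normal_prob (m s : R) (f : R -> \bar R) :
  measurable_fun setT f -> (forall x, 0 <= f x)%E ->
  (\int[normal_prob m s]_x f x = \int[mu]_x (f x * (normal_pdf m s x)%:E))%E.
Proof.
move=> mf f0; have dom := @normal_prob_dominates R m s.
rewrite -(Radon_Nikodym_SigmaFinite.change_of_variables dom f0 measurableT mf).
have mpdf : measurable_fun setT (fun x : R => (normal_pdf m s x)%:E).
  by apply/measurable_EFinP; exact: measurable_normal_pdf.
have iRN := Radon_Nikodym_SigmaFinite.f_integrable dom.
have mRN := measurable_int _ iRN.
apply: ae_eq_integral => //; [exact: emeasurable_funM|exact: emeasurable_funM|].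
apply: ae_eqe_mul2l; apply: integral_ae_eq => //.
by move=> E _ mE; rewrite -Radon_Nikodym_SigmaFinite.f_integral.
Qed.

(** Completing the square shifts the mean of the density by [l * s ^+ 2]. *)
Lemma normal_exponential_moment (l s : R) : 0 < s ->
  (\int[normal_prob 0%R s]_x (expR (l * x))%:E = (expR (l ^+ 2 * s ^+ 2 / 2))%:E)%E.
Proof.
move=> s0; rewrite ge0_integral_normal_prob; last 2 first.
- apply/measurable_EFinP; apply: measurableT_comp => //; exact: measurable_funM.
- by move=> x; rewrite lee_fin expR_ge0.
have sn0 : s != 0 by rewrite gt_eqF.
transitivity (\int[mu]_x ((expR (l ^+ 2 * s ^+ 2 / 2))%:E
    * (normal_pdf (l * s ^+ 2) s x)%:E))%E.
  apply: eq_integral => x _; rewrite -!EFinM !normal_pdfE//; congr (_%:E).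
  rewrite /normal_fun mulrCA [RHS]mulrCA; congr (_ * _); rewrite -!expRD.
  by congr expR; field.
rewrite ge0_integralZl//.
- by rewrite integral_normal_pdf mule1.
- by apply/measurable_EFinP; exact: measurable_normal_pdf.
- by move=> x _; rewrite lee_fin normal_pdf_ge0.
Qed.

End gaussian.

(** * Conditioning on a sub-sigma-algebra *)

Section sub_sigma_algebra.
Context d (T : measurableType d) (R : realType).

Lemma generated_measurable (G : set (set T)) E :
  G `<=` measurable -> <<s G >> E -> measurable E.
Proof. by move=> GT; apply: smallest_sub => //; exact: sigma_algebra_measurable. Qed.

Lemma measurable_fun_generated d' (U : measurableType d') (G : set (set T))
    (f : T -> U) : G `<=` measurable ->
  measurable_fun setT (f : g_sigma_algebraType G -> U) -> measurable_fun setT f.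
Proof. by move=> GT mf _ A mA; apply: (generated_measurable GT); exact: mf. Qed.

Lemma measurable_fun_generatedS d' (U : measurableType d') (G H : set (set T))
    (f : T -> U) : G `<=` <<s H >> ->
  measurable_fun setT (f : g_sigma_algebraType G -> U) ->
  measurable_fun setT (f : g_sigma_algebraType H -> U).
Proof.
move=> GH mf _ A mA; have : <<s G >> (setT `&` f @^-1` A) by exact: mf.
by apply: smallest_sub => //; exact: smallest_sigma_algebra.
Qed.

Section independence.
Context (P : probability T R) (G : set (set T)) (D : T -> R)
  (N : probability (measurableTypeR R) R).
Hypothesis GT : G `<=` measurable.
Hypothesis mD : measurable_fun setT D.
Hypothesis indep : forall E, <<s G >> E -> forall A : set R, measurable A ->
  P (E `&` D @^-1` A) = (P E * N A)%E.

(** Independence makes the joint law of the identity, seen in the coarser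
    sigma-algebra, and of [D] a product measure, to which Tonelli applies. *)
Lemma ge0_integral_independent (Z : T -> \bar R) (f : R -> \bar R) :
  measurable_fun setT (Z : g_sigma_algebraType G -> \bar R) ->
  (forall w, 0 <= Z w)%E ->
  measurable_fun setT f -> (forall x, 0 <= f x)%E ->
  (\int[P]_w (Z w * f (D w)) = \int[P]_w Z w * \int[N]_x f x)%E.
Proof.
move=> mZ Z0 mf f0.
pose idG : T -> g_sigma_algebraType G := idfun.
have midG : measurable_fun setT idG.
  by move=> _ A mA; rewrite setTI; exact: (generated_measurable GT).
pose pr w : g_sigma_algebraType G * measurableTypeR R := (idG w, D w).
have mpr : measurable_fun setT pr by apply/measurable_fun_pairP; split.
pose idm : {mfun T >-> g_sigma_algebraType G} :=
  HB.pack idG (isMeasurableFun.Build _ _ _ _ _ midG).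
pose prm : {mfun T >-> (g_sigma_algebraType G * measurableTypeR R)%type} :=
  HB.pack pr (isMeasurableFun.Build _ _ _ _ _ mpr).
pose PG := distribution P idm.
pose PD := distribution P prm.
have PDE X : measurable X -> (PG \x N)%E X = PD X.
  apply: product_measure_unique => A B mA mB.
  by rewrite /PD /PG /distribution /pushforward /= -indep.
pose h (x : g_sigma_algebraType G * measurableTypeR R) := (Z x.1 * f x.2)%E.
have mh : measurable_fun setT h.
  by apply: emeasurable_funM; apply: measurableT_comp.
have h0 x : (0 <= h x)%E by rewrite mule_ge0.
transitivity (\int[PD]_x h x)%E.
  by rewrite ge0_integral_pushforward.
transitivity (\int[(PG \x N)%E]_x h x)%E.
  by apply: eq_measure_integral => A mA _; exact/esym/PDE.
rewrite fubini_tonelli1//= /fubini_F /h/=.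
under eq_integral do rewrite ge0_integralZl//.
rewrite ge0_integralZr//; last by apply: integral_ge0.
by rewrite ge0_integral_pushforward.
Qed.

End independence.
End sub_sigma_algebra.

(** * A maximal inequality for predictably chosen increments *)

(** A discrete substitute for a stochastic integral: increments with controlled
    conditional exponential moments, selected by a predictable index, still make
    the exponential of their sum a supermartingale up to a factor [C] by step. *)

Section maximal_inequality.
Context d (T : measurableType d) (R : realType) (P : probability T R).
Variables (F : nat -> set (set T)) (L : nat -> T -> nat) (D : nat -> nat -> T -> R)
  (N : nat) (C b : R).
Hypothesis FT : forall k, F k `<=` measurable.
Hypothesis FS : forall k, F k `<=` <<s F k.+1 >>.
Hypothesis LN : forall k w, (L k w < N)%N.
Hypothesis mL : forall k j, <<s F k >> (L k @^-1` [set j]).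
Hypothesis mD : forall k j, measurable_fun setT (D k j : g_sigma_algebraType (F k.+1) -> R).
Hypothesis C1 : 1 <= C.
Hypothesis expD : forall k j (Z : T -> \bar R),
  measurable_fun setT (Z : g_sigma_algebraType (F k) -> \bar R) ->
  (forall w, 0 <= Z w)%E ->
  (\int[P]_w (Z w * (expR (D k j w))%:E) <= C%:E * \int[P]_w Z w)%E.

Definition chosen_walk n w : R := \sum_(k < n) D k (L k w) w.

Definition chosen j k (Y : T -> R) : set T := [set w | Y w < b /\ L k w = j].

(** The chosen walk stopped on reaching [b]; the indicators split its next value
    into finitely many cases, each carrying one increment. *)
Fixpoint stopped_walk n : T -> R :=
  if n is k.+1 then
    fun w => stopped_walk k w +
      \sum_(j < N) \1_(chosen j k (stopped_walk k)) w * D k j w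
  else cst 0.

Lemma stopped_walkS k w : stopped_walk k.+1 w =
  if stopped_walk k w < b then stopped_walk k w + D k (L k w) w
  else stopped_walk k w.
Proof.
rewrite /=; case: ifPn => [lt|nlt].
  rewrite (bigD1 (Ordinal (LN k w)))//= big1 ?addr0 => [|j].
    by rewrite indicE mem_set ?mul1r.
  move=> jL; rewrite indicE memNset ?mul0r//= => -[_ e].
  by move/negP: jL; apply; apply/eqP/val_inj.
rewrite big1 ?addr0// => j _; rewrite indicE memNset ?mul0r//= => -[lt _].
by rewrite lt in nlt.
Qed.

Lemma measurable_chosen j k :
  measurable_fun setT (stopped_walk k : g_sigma_algebraType (F k) -> R) ->
  <<s F k >> (chosen j k (stopped_walk k)).
Proof.
move=> mY.
pose A : set (g_sigma_algebraType (F k)) := stopped_walk k @^-1` `]-oo, b[.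
have mA : measurable A by rewrite -[A]setTI; apply: mY.
have mB : measurable (L k @^-1` [set j] : set (g_sigma_algebraType (F k))).
  exact: mL.
rewrite (_ : chosen _ _ _ = A `&` L k @^-1` [set j]).
  exact: (measurableI _ _ mA mB).
by apply/seteqP; split=> w; rewrite /A/chosen/= in_itv.
Qed.

Lemma measurable_stopped_walk k :
  measurable_fun setT (stopped_walk k : g_sigma_algebraType (F k) -> R).
Proof.
elim: k => [|k IH]; first exact: measurable_cst.
have mYS : measurable_fun setT (stopped_walk k : g_sigma_algebraType (F k.+1) -> R).
  exact: measurable_fun_generatedS IH.
apply: measurable_funD => //; apply: measurable_sum => j.
apply: measurable_funM => //; apply: measurable_indic.
apply: (smallest_sub _ _ (measurable_chosen j IH)) => //.
exact: smallest_sigma_algebra.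
Qed.

(** Splitting according to the chosen increment, each of the at most [N]
    pieces gains a factor of at most [C]. *)
Lemma stopped_walk_exp k :
  (\int[P]_w (expR (stopped_walk k w))%:E <= (C ^+ k)%:E)%E.
Proof.
elim: k => [|k IH].
  by rewrite /= expR0 integral_cst//= probability_setT mule1.
have mY := @measurable_stopped_walk k.
pose G := g_sigma_algebraType (F k).
pose A j := chosen j k (stopped_walk k).
pose S := [set w | b <= stopped_walk k w].
pose ZS w := ((\1_S w)%:E * (expR (stopped_walk k w))%:E)%E.
pose Z (j : 'I_N) w := ((\1_(A j) w)%:E * (expR (stopped_walk k w))%:E)%E.
have mexp : measurable_fun setT ((fun w => (expR (stopped_walk k w))%:E) : G -> \bar R).
  by apply/measurable_EFinP; apply: measurableT_comp.
have mZ j : measurable_fun setT (Z j : G -> \bar R).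
  apply: emeasurable_funM => //; apply/measurable_EFinP; apply: measurable_indic.
  exact: measurable_chosen.
have mZS : measurable_fun setT (ZS : G -> \bar R).
  apply: emeasurable_funM => //; apply/measurable_EFinP; apply: measurable_indic.
  rewrite (_ : S = setT `&` (stopped_walk k : G -> R) @^-1` `[b, +oo[); first exact: mY.
  by rewrite setTI; apply/seteqP; split=> w; rewrite /S/= in_itv/= andbT.
have Z0 j w : (0 <= Z j w)%E by rewrite mule_ge0 ?lee_fin ?expR_ge0.
have ZS0 w : (0 <= ZS w)%E by rewrite mule_ge0 ?lee_fin ?expR_ge0.
have mT (f : T -> \bar R) : measurable_fun setT (f : G -> \bar R) ->
    measurable_fun setT f by exact: measurable_fun_generated.
have mDT j : measurable_fun setT (fun w => (expR (D k j w))%:E).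
  apply/measurable_EFinP; apply: measurableT_comp => //.
  exact: (measurable_fun_generated (@FT k.+1)).
have part w : (ZS w + \sum_(j < N) Z j w = (expR (stopped_walk k w))%:E)%E.
  have [lt|ge] := ltP (stopped_walk k w) b.
    rewrite /ZS indicE memNset ?mul0e ?add0e; last first.
      by rewrite /S/= leNgt lt.
    rewrite (bigD1 (Ordinal (LN k w)))//= big1 ?adde0 => [|j jL].
      by rewrite /Z indicE mem_set ?mul1e.
    rewrite /Z indicE memNset ?mul0e//= => -[_ e].
    by move/negP: jL; apply; apply/eqP/val_inj.
  rewrite /ZS indicE mem_set// mul1e big1 ?adde0// => j _.
  rewrite /Z indicE memNset ?mul0e//= => -[].
  by rewrite ltNge ge.
have partS w : (ZS w + \sum_(j < N) Z j w * (expR (D k j w))%:E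
    = (expR (stopped_walk k.+1 w))%:E)%E.
  rewrite stopped_walkS; have [lt|ge] := ltP (stopped_walk k w) b.
    rewrite /ZS indicE memNset ?mul0e ?add0e; last first.
      by rewrite /S/= leNgt lt.
    rewrite (bigD1 (Ordinal (LN k w)))//= big1 ?adde0 => [|j jL].
      by rewrite /Z indicE mem_set ?mul1e// expRD EFinM.
    rewrite /Z indicE memNset ?mul0e//= => -[_ e].
    by move/negP: jL; apply; apply/eqP/val_inj.
  rewrite /ZS indicE mem_set// mul1e big1 ?adde0// => j _.
  rewrite /Z indicE memNset ?mul0e//= => -[].
  by rewrite ltNge ge.
under eq_integral do rewrite -partS.
rewrite ge0_integralD//; last 3 first.
- exact: mT.
- by move=> w _; apply: sume_ge0 => j _; rewrite mule_ge0// lee_fin expR_ge0.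
- by apply: emeasurable_sum => j; apply: emeasurable_funM => //; exact: mT.
rewrite ge0_integral_sum//; last 2 first.
- by move=> j; apply: emeasurable_funM => //; exact: mT.
- by move=> j w _; rewrite mule_ge0// lee_fin expR_ge0.
apply: (@le_trans _ _ (C%:E * \int[P]_w (expR (stopped_walk k w))%:E)%E); last first.
  by rewrite exprS EFinM lee_pmul2l// lte_fin (lt_le_trans ltr01).
under [in leRHS]eq_integral do rewrite -part.
rewrite [in leRHS]ge0_integralD//; last 3 first.
- exact: mT.
- by move=> w _; apply: sume_ge0.
- by apply: emeasurable_sum => j; exact: mT.
rewrite [in leRHS]ge0_integral_sum//; last by move=> j; exact: mT.
rewrite ge0_muleDr; last 2 first.
- by apply: integral_ge0.
- by apply: sume_ge0 => j _; apply: integral_ge0.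
apply: leeD.
  by rewrite -[leLHS]mul1e lee_wpmul2r ?lee_fin//; apply: integral_ge0.
rewrite ge0_sume_distrr; last by move=> j _; apply: integral_ge0.
by apply: lee_sum => j _; exact: expD.
Qed.

Lemma stopped_walk_reaches n w k : (k <= n)%N -> b <= chosen_walk k w ->
  b <= stopped_walk n w.
Proof.
have inv m : b <= stopped_walk m w \/ stopped_walk m w = chosen_walk m w.
  elim: m => [|m IH]; first by right; rewrite /chosen_walk big_ord0.
  rewrite stopped_walkS; case: ltP IH => [lt|le] IH; last by left.
  right; case: IH => [//|->].
  by rewrite /chosen_walk big_ord_recr.
move=> kn bk; rewrite -(subnKC kn).
elim: (n - k)%N => [|m IH]; first by rewrite addn0; case: (inv k) => // ->.
by rewrite addnS stopped_walkS ltNge IH.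
Qed.

(** Reaching [b] at some time forces the stopped walk to be above [b] at the end,
    where Markov's inequality applies to its exponential. *)
Lemma chosen_walk_maximal n : exists2 E, measurable E &
  (forall w k, (k <= n)%N -> b <= chosen_walk k w -> E w) /\
  (P E <= (expR (- b) * C ^+ n)%:E)%E.
Proof.
have mY : measurable_fun setT (stopped_walk n).
  exact: (measurable_fun_generated (@FT n) (@measurable_stopped_walk n)).
exists (stopped_walk n @^-1` `[b, +oo[).
  by rewrite -[X in measurable X]setTI; exact: mY.
split.
  by move=> w k kn bk; rewrite /= in_itv /= andbT; exact: stopped_walk_reaches bk.
set E := _ @^-1` _.
have mE : measurable E by rewrite -[X in measurable X]setTI; exact: mY.
have mexp : measurable_fun setT (fun w => (expR (stopped_walk n w))%:E).
  by apply/measurable_EFinP; apply: measurableT_comp.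
have : ((expR b)%:E * P E <= (C ^+ n)%:E)%E.
  apply: le_trans (stopped_walk_exp n).
  rewrite -integral_cst//.
  apply: (@le_trans _ _ (\int[P]_(w in E) (expR (stopped_walk n w))%:E)%E).
    apply: ge0_le_integral => //.
    - by move=> w _; rewrite lee_fin expR_ge0.
    - exact: measurable_funTS.
    - by move=> w; rewrite /E/= in_itv/= andbT lee_fin ler_expR.
  exact: ge0_subset_integral.
by rewrite expRN EFinM lee_pdivlMl ?expR_gt0.
Qed.

End maximal_inequality.

(** * Independence of the past and of future increments *)

Section pi_lambda.
Context d (T : measurableType d) (R : realType) (P : probability T R).

Lemma independent_generated (G : set (set T)) (D : set T) :
  setI_closed G -> G `<=` measurable -> measurable D ->
  (forall E, G E -> P (E `&` D) = (P E * P D)%E) ->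
  forall E, <<s G >> E -> P (E `&` D) = (P E * P D)%E.
Proof.
move=> GI GT mD indep E GE.
suff : [set A | measurable A /\ P (A `&` D) = (P A * P D)%E] E by case.
have fP A : measurable A -> P A \is a fin_num by exact: fin_num_measure.
move: E GE; apply: lambda_system_subset => //; last first.
  by move=> A GA; split; [exact: GT|exact: indep].
apply/dynkin_lambda_system; split.
- by split => //; rewrite setTI probability_setT mul1e.
- move=> A [mA iA]; split; first exact: measurableC.
  have -> : P (~` A `&` D) = (P D - P (A `&` D))%E.
    by rewrite setIC -setDE measureD// 1?[A `&` D]setIC// ltey_eq fP.
  rewrite iA probability_setC// muleBl ?mul1e ?fP//.
- move=> A tA mA; split; first by apply: bigcup_measurable => k _; exact: (mA k).1.
  rewrite setI_bigcupl measure_bigcup//; last 2 first.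
    by move=> k _; apply: measurableI => //; exact: (mA k).1.
    exact: trivIset_setIr.
  rewrite measure_bigcup//; last by move=> k _; exact: (mA k).1.
  rewrite -[in RHS](fineK (fP _ mD)) muleC -nneseriesZl; last first.
    by move=> i _; exact: measure_ge0.
  apply: eq_eseriesr => i _.
  by rewrite [LHS](mA i).2 muleC fineK// fP.
Qed.

End pi_lambda.

(** The noises are extended by [0] to negative times, so that the past of a noise
    that has not started yet is trivial. Independence between the noises and
    between the increments of each is expressed at once, on rectangular arrays of
    increments. *)
Record driving_noises d (T : measurableType d) (R : realType)
    (P : probability T R) (X : nat -> R -> T -> R) : Prop := DrivingNoises {
  noise_frozen : forall l x w, x <= 0 -> X l x w = 0;
  noise_continuous : forall l w, continuous (X l ^~ w);
  noise_measurable : forall l x, measurable_fun setT (X l x);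
  noise_law : forall l s t, 0 <= s -> s < t -> forall A : set R, measurable A ->
    P ((fun w => X l t w - X l s w) @^-1` A) = normal_prob 0 (Num.sqrt (t - s)) A;
  noise_independent : forall N K (u : nat -> nat -> R) (A : nat -> nat -> set R),
    (forall l, 0 <= u l 0%N) ->
    (forall l, {homo u l : m n / (m <= n)%N >-> m <= n}) ->
    (forall l k, measurable (A l k)) ->
    P [set w | forall l k, (l < N)%N -> (k < K)%N ->
         A l k (X l (u l k.+1) w - X l (u l k) w)] =
    (\prod_(l < N) \prod_(k < K)
       P ((fun w => (X l (u l k.+1) w - X l (u l k) w)%R) @^-1` A l k))%E
}.

Section past.
Context d (T : measurableType d) (R : realType) (P : probability T R)
  (X : nat -> R -> T -> R) (start : nat -> R).
Hypothesis HX : driving_noises P X.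

(** The noise [l] is indexed by the time elapsed since [start l]. *)
Definition past (t : R) : set (set T) :=
  [set E | exists l x (A : set R), [/\ x <= t - start l, measurable A &
     E = X l x @^-1` A]].

Lemma past_measurable t : past t `<=` measurable.
Proof.
move=> _ [l [x [A [_ mA ->]]]]; rewrite -[X in measurable X]setTI.
exact: (noise_measurable HX).
Qed.

Lemma past_subset s t : s <= t -> past s `<=` <<s past t >>.
Proof.
move=> st E [l [x [A [xs mA ->]]]]; apply: sub_sigma_algebra.
by exists l, x, A; split => //; rewrite (le_trans xs)// lerB.
Qed.

Lemma measurable_past l x t : x <= t - start l ->
  measurable_fun setT (X l x : g_sigma_algebraType (past t) -> R).
Proof.
by move=> h _ A mA; rewrite setTI; apply: sub_sigma_algebra; exists l, x, A.
Qed.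

(** Finite intersections of generators of the past, defined inductively so that
    stability under intersection is an induction. *)
Inductive cylinder t : set (set T) :=
| cylinderT : cylinder t setT
| cylinderI l x A E : x <= t - start l -> measurable A -> cylinder t E ->
    cylinder t (X l x @^-1` A `&` E).

Lemma cylinder_setI_closed t : setI_closed (cylinder t).
Proof.
move=> E F; elim=> [|l x A E' h mA _ IH] cF; first by rewrite setTI.
by rewrite -setIA; apply: cylinderI => //; exact: IH.
Qed.

Lemma cylinder_measurable t : cylinder t `<=` measurable.
Proof.
move=> E; elim=> // l x A E' h mA _ IH; apply: measurableI => //.
by apply: past_measurable; exists l, x, A; split; first exact: h.
Qed.

Section increments.
Variables (N K : nat) (u : nat -> nat -> R).
Hypothesis u0 : forall l, u l 0%N = 0.
Hypothesis uS : forall l, {homo u l : m n / (m <= n)%N >-> m <= n}.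

Definition increment l k w := X l (u l k.+1) w - X l (u l k) w.

Definition boxes : set (set T) := [set E | exists A : nat -> nat -> set R,
  (forall l k, measurable (A l k)) /\
  E = [set w | forall l k, (l < N)%N -> (k < K)%N -> A l k (increment l k w)]].

Lemma measurable_increment l k : measurable_fun setT (increment l k).
Proof. by apply: measurable_funB; exact: (noise_measurable HX). Qed.

Lemma boxes_setI_closed : setI_closed boxes.
Proof.
move=> _ _ [A [mA ->]] [B [mB ->]]; exists (fun l k => A l k `&` B l k).
split=> [l k|]; first exact: measurableI.
apply/seteqP; split=> w /=.
  by move=> [h1 h2] l k lN kK; split; [exact: h1|exact: h2].
by move=> h; split=> l k lN kK; have [] := h l k lN kK.
Qed.

Lemma boxes_measurable : boxes `<=` measurable.
Proof.
move=> _ [A [mA ->]].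
rewrite (_ : [set w | _] = \bigcap_(l in `I_N) \bigcap_(k in `I_K)
    (increment l k @^-1` A l k)).
  apply: bigcap_measurableType => l _; apply: bigcap_measurableType => k _.
  by rewrite -[X in measurable X]setTI; exact: measurable_increment.
apply/seteqP; split=> w /=.
  by move=> h l lN k kK; exact: h.
by move=> h l k lN kK; exact: h.
Qed.

Lemma measurable_boxes l k : (l < N)%N -> (k <= K)%N ->
  measurable_fun setT (X l (u l k) : g_sigma_algebraType boxes -> R).
Proof.
move=> lN; elim: k => [|k IH] kK.
  rewrite (_ : X l (u l 0%N) = cst 0); first exact: measurable_cst.
  by apply/funext => w; rewrite (noise_frozen HX)// u0.
have -> : X l (u l k.+1) = increment l k \+ X l (u l k).
  by apply/funext => w; rewrite /= /increment subrK.
apply: measurable_funD; last by apply: IH; exact: ltnW.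
move=> _ A mA; rewrite setTI; apply: sub_sigma_algebra.
exists (fun l' k' => if (l' == l) && (k' == k) then A else setT).
split=> [l' k'|]; first by case: ifP.
apply/seteqP; split=> w /=.
  by move=> Aw l' k' _ _; case: ifP => // /andP[/eqP -> /eqP ->].
by move=> /(_ l k lN kK); rewrite !eqxx.
Qed.

Lemma independent_boxes l (A : set R) E : (l < N)%N -> measurable A ->
  <<s boxes >> E ->
  P (E `&` increment l K @^-1` A) = (P E * P (increment l K @^-1` A))%E.
Proof.
move=> lN mA; apply: independent_generated.
- exact: boxes_setI_closed.
- exact: boxes_measurable.
- by rewrite -[X in measurable X]setTI; exact: measurable_increment.
move=> _ [B [mB ->]].
pose B' l' k' := if (k' < K)%N then B l' k' else if l' == l then A else setT.
have mB' l' k' : measurable (B' l' k').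
  by rewrite /B'; case: ifP => // _; case: ifP.
have u0' l' : 0 <= u l' 0%N by rewrite u0.
rewrite (_ : _ `&` _ = [set w | forall l' k', (l' < N)%N -> (k' < K.+1)%N ->
    B' l' k' (increment l' k' w)]); last first.
  apply/seteqP; split=> w /=; rewrite /B'.
    move=> [h Aw] l' k' l'N; rewrite ltnS leq_eqVlt => /predU1P[->|kK].
      by rewrite ltnn; case: eqP => // ->.
    by rewrite kK; exact: h.
  move=> h; split=> [l' k' l'N kK|].
    by have := h l' k' l'N (ltnW kK); rewrite kK.
  by have := h l K lN (leqnn _); rewrite ltnn eqxx.
rewrite (noise_independent HX N K.+1 u0' uS mB').
rewrite (noise_independent HX N K u0' uS mB).
under eq_bigr do rewrite big_ord_recr.
rewrite big_split /=; congr (_ * _)%E.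
  apply: eq_bigr => l' _; apply: eq_bigr => k _.
  by rewrite /B' ltn_ord.
rewrite (bigD1 (Ordinal lN))//= /B' ltnn eqxx big1 ?mule1// => l' nl.
have -> : (l' == l :> nat) = false by apply/negbTE.
by rewrite preimage_setT probability_setT.
Qed.

End increments.

(** A subdivision of the life of the noise [l] for which the values of that noise
    at the times in [s] already lived at time [t] are sums of increments, and for
    which the increment number [(size s).+1] is the one between the times [t] and
    [t']. Its length does not depend on [l], so that the independence of a
    rectangular array of increments can be used. *)
Definition grid (t t' : R) (s : seq R) l k : R :=
  if k is k'.+1 then
    if (k' < size s)%N then
      Num.min (Num.max 0 (t - start l)) (Num.max 0 (nth 0 (sort <=%R s) k'))
    else if k' == size s then Num.max 0 (t - start l)
    else Num.max 0 (t' - start l)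
  else 0.

Lemma grid_nondecreasing t t' s l : t <= t' ->
  {homo grid t t' s l : m n / (m <= n)%N >-> m <= n}.
Proof.
move=> tt'; apply: homo_leq => [//|x y z|]; first exact: le_trans.
have r0 a : 0 <= Num.max 0 (a - start l) by rewrite le_max lexx.
case=> [|k] /=.
  case: ifP => _; last by case: ifP => _.
  by rewrite le_min r0 le_max lexx.
have [k1|k1] := ltnP k.+1 (size s).
  rewrite (ltnW k1); apply: le_min2 => //; apply: le_max2 => //.
  apply: (sorted_leq_nth le_trans le_refl 0 (sort_le_sorted s)) => //;
    by rewrite inE size_sort ?k1 ?(ltnW k1).
have [k2|k2] := ltnP k (size s).
  have -> : k.+1 == size s by rewrite eqn_leq k1 k2.
  by rewrite ge_min lexx.
have -> : k.+1 == size s = false by apply/negbTE; rewrite gtn_eqF.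
case: ifP => // _; apply: le_max2 => //.
by rewrite lerB.
Qed.

Lemma grid_now t t' s l : start l <= t -> grid t t' s l (size s).+1 = t - start l.
Proof. by move=> h; rewrite /= ltnn eqxx max_r// subr_ge0. Qed.

Lemma grid_later t t' s l : start l <= t' ->
  grid t t' s l (size s).+2 = t' - start l.
Proof.
move=> h; rewrite /= ltnNge leqnSn /= gtn_eqF ?ltnSn// max_r// subr_ge0//.
Qed.

Lemma grid_mem t t' s l x : x \in s -> 0 <= x -> x <= t - start l ->
  exists2 k, (k <= (size s).+1)%N & grid t t' s l k = x.
Proof.
move=> xs x0 xt; exists (index x (sort <=%R s)).+1.
  by rewrite ltnS -(size_sort <=%R) index_size.
have xss : x \in sort <=%R s by rewrite mem_sort.
rewrite /= -(size_sort <=%R) index_mem xss nth_index// (max_r x0) min_r//.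
by rewrite le_max xt orbT.
Qed.

(** The quantification over all larger arrays lets the induction merge the arrays
    obtained for the factors of an intersection. *)
Lemma cylinder_boxes t t' E : t <= t' -> cylinder t E ->
  exists N0 (s0 : seq R), forall N s, (N0 <= N)%N -> {subset s0 <= s} ->
    <<s boxes N (size s).+1 (grid t t' s) >> E.
Proof.
move=> tt'; elim=> [|l x A {}E xt mA _ [N0 [s0 IH]]].
  exists 0%N, [::] => N s _ _.
  exact: (@measurableT _ (g_sigma_algebraType (boxes N (size s).+1 (grid t t' s)))).
exists (maxn l.+1 N0), (x :: s0) => N s.
rewrite geq_max => /andP[lN N0N] sub.
have mE : (measurable : set (set (g_sigma_algebraType
    (boxes N (size s).+1 (grid t t' s))))) E.
  by apply: IH => // y ys; apply: sub; rewrite inE ys orbT.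
suff mX : measurable_fun setT (X l x : g_sigma_algebraType
    (boxes N (size s).+1 (grid t t' s)) -> R).
  apply: (@measurableI _ (g_sigma_algebraType (boxes N (size s).+1 (grid t t' s)))) => //.
  by rewrite -[_ @^-1` _]setTI; exact: mX.
have [x0|x0] := leP x 0.
  rewrite (_ : X l x = cst 0); first exact: measurable_cst.
  by apply/funext => w; rewrite (noise_frozen HX).
have [|k kK <-] := @grid_mem t t' s l x _ (ltW x0) xt.
  by apply: sub; rewrite mem_head.
exact: measurable_boxes.
Qed.

(** Two applications of the pi-lambda theorem: from rectangles of increments to all
    events about these increments, cylinders among them, and from cylinders to
    the whole past. *)
Lemma future_independent l t t' (A : set R) E : start l <= t -> t < t' ->
  measurable A -> <<s past t >> E ->
  P (E `&` (fun w => X l (t' - start l) w - X l (t - start l) w) @^-1` A) =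
  (P E * normal_prob 0%R (Num.sqrt (t' - t)) A)%E.
Proof.
move=> lt tt' mA pE.
set D := _ @^-1` A.
have <- : P D = normal_prob 0%R (Num.sqrt (t' - t)) A.
  have e : t' - start l - (t - start l) = t' - t by ring.
  by rewrite -e; apply: (noise_law HX) => //; rewrite ?subr_ge0// ltrD2r.
have mD : measurable D.
  rewrite -[D]setTI; apply: measurable_funB => //; exact: (noise_measurable HX).
have : <<s cylinder t >> E.
  move: E pE; apply: smallest_sub; first exact: smallest_sigma_algebra.
  move=> _ [m [x [B [xt mB ->]]]]; apply: sub_sigma_algebra.
  by rewrite -[_ @^-1` _]setIT; apply: cylinderI => //; exact: cylinderT.
apply: independent_generated => //.
- exact: cylinder_setI_closed.
- exact: cylinder_measurable.
move=> F cF; have [N0 [s0 main]] := cylinder_boxes (ltW tt') cF.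
have := @independent_boxes (maxn l.+1 N0) (size s0).+1 (grid t t' s0) (fun=> erefl)
  (fun m => grid_nondecreasing s0 m (ltW tt')) l A F.
rewrite leq_max ltnSn /= => /(_ isT mA).
rewrite /increment grid_later ?(le_trans lt) ?ltW// grid_now// -/D.
by apply; apply: main => //; rewrite leq_maxr.
Qed.

Lemma future_exponential_moment l t t' (a : R) (Z : T -> \bar R) :
  start l <= t -> t < t' ->
  measurable_fun setT (Z : g_sigma_algebraType (past t) -> \bar R) ->
  (forall w, 0 <= Z w)%E ->
  (\int[P]_w (Z w * (expR (a * (X l (t' - start l) w - X l (t - start l) w)%R))%:E)
   = (expR (a ^+ 2 * (t' - t)%R / 2))%:E * \int[P]_w Z w)%E.
Proof.
move=> lt tt' mZ Z0.
have s0 : 0 < Num.sqrt (t' - t) by rewrite sqrtr_gt0 subr_gt0.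
rewrite (@ge0_integral_independent _ _ _ P (past t)
   (fun w => X l (t' - start l) w - X l (t - start l) w)
   (normal_prob 0%R (Num.sqrt (t' - t))) _ _ _ Z (fun x => (expR (a * x))%:E))//.
- by rewrite normal_exponential_moment// sqr_sqrtr ?subr_ge0 1?ltW// muleC.
- exact: past_measurable.
- by apply: measurable_funB; exact: (noise_measurable HX).
- by move=> E pE A mA; exact: future_independent.
- apply/measurable_EFinP; apply: measurableT_comp => //; exact: measurable_funM.
Qed.

End past.

(** * The coalescing paths are adapted to the past *)

Section rational_zero.
Context {R : realType}.

(** Zeros of a continuous function on a segment can be detected on rational
    points of the segment, which turns meeting events into countable ones. *)
Lemma exists_zero_rat (f : R -> R) (m t : R) : continuous f -> m <= t ->
  (exists u, [/\ m <= u, u <= t & f u = 0]) <->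
  (forall n : nat, exists q : rat, [/\ 0 <= ratr q :> R, ratr q <= 1 :> R &
     `|f (m + (t - m) * ratr q)| < n.+1%:R^-1]).
Proof.
move=> cf mt; pose g x := `|f (m + (t - m) * x)|.
have cg : continuous g.
  move=> x; apply: (@cvg_norm _ R^o).
  apply: (cvg_comp (fun x => m + (t - m) * x)); last exact: cf.
  apply: cvgD; first exact: cvg_cst.
  by apply: cvgM; [exact: cvg_cst|exact: cvg_id].
split=> [[u [mu ut fu]] n|approx].
  have [x [x0 x1 gx]] : exists x, [/\ 0 <= x, x <= 1 & g x = 0].
    move: mt; rewrite le_eqVlt => /predU1P[e|lt].
      exists 0; split=> //; rewrite /g mulr0 addr0.
      by have -> : m = u by [apply/eqP; rewrite eq_le mu e ut]; rewrite fu normr0.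
    have tm0 : 0 < t - m by rewrite subr_gt0.
    exists ((u - m) / (t - m)); split.
    - by rewrite divr_ge0// ?subr_ge0// ltW.
    - by rewrite ler_pdivrMr// mul1r lerD2r.
    - by rewrite /g mulrC divfK ?gt_eqF// addrC subrK fu normr0.
  have [x1'|x1'] := leP 1 x.
    exists 1%Q; rewrite rmorph1 ler01 lexx; split=> //.
    have e : x = 1 by apply/eqP; rewrite eq_le x1 x1'.
    by move: gx; rewrite e /g => ->; rewrite invr_gt0.
  have n0 : 0 < n.+1%:R^-1 :> R by rewrite invr_gt0.
  have /cvgrPdist_lt /(_ _ n0) := cg x.
  rewrite gx; move=> /nbhs_ballP[e /= e0 He].
  have : x < Num.min 1 (x + e) by rewrite lt_min x1' ltrDl.
  move=> /rat_in_itvoo[q]; rewrite in_itv/= lt_min => /and3P[xq q1 qe].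
  exists q; split; [exact: le_trans (ltW xq)|exact: ltW|].
  have := He (ratr q); rewrite /ball/= sub0r normrN normr_id; apply.
  by rewrite ltr_norml; apply/andP; split; lra.
have [||c /[!in_itv]/= /andP[c0 c1] cmin] := @EVT_min R g 0 1.
- exact: ler01.
- by apply: continuous_subspaceT => x; exact: cg.
exists (m + (t - m) * c); split.
- by rewrite lerDl mulr_ge0// subr_ge0.
- by rewrite -lerBrDl ler_piMr// subr_ge0.
apply/normr0_eq0/eqP; rewrite -/(g c); apply/contraT => gc.
have gc0 : 0 < g c by rewrite lt_neqAle eq_sym gc normr_ge0.
have [q [q0 q1 gq]] := approx (Num.truncn (g c)^-1).
have := cmin (ratr q); rewrite in_itv/= q0 q1 => /(_ isT).
rewrite leNgt => /negP; case; apply: lt_trans gq _.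
by rewrite invf_plt ?posrE// truncnS_gt.
Qed.

End rational_zero.

Section adapted.
Context d (T : measurableType d) (R : realType) (P : probability T R)
  (X : nat -> R -> T -> R) (pt : nat -> R * R) (B : nat -> R -> T -> R).
Hypothesis HX : driving_noises P X.
Local Notation start i := (pt i).2.
Local Notation noise w := (fun l x => X l x w).
Local Notation path w := (fun l x => B l x w).
Local Notation drive w := (driving_path pt (noise w)).
Hypothesis HB : forall w, coalescing_system pt (noise w) (path w).
Local Notation past := (past X (fun l => start l)).
Local Notation adapted t f := (measurable_fun setT (f : g_sigma_algebraType (past t) -> R)).

Let Wc w i : continuous (noise w i). Proof. exact: (noise_continuous HX). Qed.

Lemma adaptedS s t f : s <= t -> adapted s f -> adapted t f.
Proof. by move=> st; apply: measurable_fun_generatedS; exact: past_subset. Qed.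

Lemma drive_adapted i s t : s <= t -> adapted t (fun w => drive w i s).
Proof.
move=> st; apply: measurable_funD; first exact: measurable_cst.
by apply: measurable_past => /=; rewrite lerB.
Qed.

Definition hits i j t : set T :=
  [set w | exists2 u, u <= t & Defs.meets pt (noise w) (path w) i j u].

Let itv_point (a t : R) (q : rat) := a + (t - a) * ratr q.

Let itv_point_le a t (q : rat) : a <= t -> 0 <= ratr q :> R -> ratr q <= 1 :> R ->
  a <= itv_point a t q <= t.
Proof.
move=> h q0 q1; rewrite /itv_point lerDl -lerBrDl mulr_ge0 ?subr_ge0//=.
by rewrite ler_piMr// subr_ge0.
Qed.

Lemma measurable_hits i j t :
  (forall u, start j <= u -> u <= t -> adapted t (B j u)) ->
  <<s past t >> (hits i j t).
Proof.
move=> adj; pose G := g_sigma_algebraType (past t).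
pose m := Num.max (start i) (start j).
have [/andP[ji mt]|no] := boolP ((j < i)%N && (m <= t)); last first.
  rewrite (_ : hits i j t = set0); first exact: (@measurable0 _ G).
  apply/seteqP; split=> w //= [u ut [ji iu ju _]].
  by move: no; rewrite ji/= -ltNge ltNge (le_trans _ ut)// ge_max iu ju.
pose f w u := drive w i u - extended_path pt (path w) j u.
have cf w : continuous (f w).
  move=> u; apply: cvgB; first exact: (drive_continuous (@Wc w)).
  exact: (extended_path_continuous (@Wc w) (HB w)).
have jm : start j <= m by rewrite le_max lexx orbT.
have hitsE : hits i j t = \bigcap_(n : nat) \bigcup_(q : rat)
    [set w | [&& 0 <= ratr q :> R, ratr q <= 1 :> R &
      `|f w (itv_point m t q)| < n.+1%:R^-1]].
  apply/seteqP; split=> w.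
    move=> [u ut [_ iu ju e]] n _.
    have [|q [q0 q1 fq]] := (exists_zero_rat (cf w) mt).1 _ n.
      exists u; split=> //; first by rewrite ge_max iu ju.
      by rewrite /f extended_pathE// e subrr.
    by exists q => //=; rewrite q0 q1.
  move=> h.
  have [n|u [mu ut fu]] := (exists_zero_rat (cf w) mt).2.
    by have [q _ /and3P[q0 q1 fq]] := h n I; exists q.
  exists u => //; split=> //; first by rewrite (le_trans _ mu)// le_max lexx.
    by rewrite (le_trans jm).
  by move: fu; rewrite /f extended_pathE ?(le_trans jm)// => /subr0_eq.
rewrite hitsE.
apply: (@bigcap_measurableType _ G) => n _.
apply: (@bigcupT_measurable_rat _ G) => q.
have [/andP[q0 q1]|no] := boolP ((0 <= ratr q :> R) && (ratr q <= 1 :> R));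
    last first.
  rewrite (_ : [set w | _] = set0); first exact: (@measurable0 _ G).
  apply/seteqP; split=> w //= /and3P[q0 q1 _].
  by move: no; rewrite q0 q1.
have /andP[v1 v2] := itv_point_le mt q0 q1.
rewrite (_ : [set w | _] = (fun w => `|drive w i (itv_point m t q) -
    B j (itv_point m t q) w|) @^-1` `]-oo, n.+1%:R^-1[); last first.
  apply/seteqP; split=> w /=; rewrite q0 q1 in_itv/= /f extended_pathE//;
  exact: le_trans v1.
rewrite -[X in _ X]setTI.
have mfun : adapted t (fun w => `|drive w i (itv_point m t q) -
    B j (itv_point m t q) w|).
  apply: measurableT_comp => //; apply: measurable_funB; first exact: drive_adapted.
  by apply: adj => //; exact: le_trans v1.
exact: mfun.
Qed.

(** The hitting times before [t] are compared at countably many times, which keeps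
    the event measurable. Ties are harmless, since paths hit at the same time have
    coalesced. *)
Definition hits_first i j t : set T :=
  hits i j t `&` \bigcap_(l in `I_i) \bigcap_(q in
     [set q : rat | 0 <= ratr q :> R /\ ratr q <= 1 :> R])
    (~` hits i l (itv_point (start i) t q) `|` hits i j (itv_point (start i) t q)).

Lemma hits_firstP i t w : start i <= t ->
  (exists j, hits i j t w) -> exists2 j, (j < i)%N & hits_first i j t w.
Proof.
move=> it [j [u ut mu]].
have [k [s [su [[ki si sk e] fs]]]] := exists_first_meeting (@Wc w) (HB w) mu.
have st := le_trans su ut.
exists k => //; split; first by exists s.
move=> l _ q _; have [[v vq mv]|] := pselect (hits i l (itv_point (start i) t q) w).
  right; exists s => //; apply: le_trans vq.
  by rewrite leNgt; apply/negP => /fs /(_ mv).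
by left.
Qed.

Lemma hits_first_follow i j t w : start i <= t -> hits_first i j t w ->
  B i t w = B j t w.
Proof.
move=> it [[u ut mu] hall].
have [k [s [su fm]]] := exists_first_meeting (@Wc w) (HB w) mu.
have [[ki si sk e] fs] := fm.
have st := le_trans su ut.
have [r [ru mr fr]] := exists_first_meeting_with (@Wc w) (HB w) mu.
have [ji ir jr er] := mr.
have sr : s <= r by rewrite leNgt; apply/negP => /fs /(_ mr).
suff ers : r = s.
  rewrite (first_meeting_follow (HB w) fm st).
  apply: (coalesce (@Wc w) (HB w) sk _ _ st); first by rewrite -ers.
  by rewrite -e -ers.
apply/eqP; rewrite eq_le sr andbT leNgt; apply/negP => lt.
have lt' : start i < t by apply: le_lt_trans si (lt_le_trans lt (le_trans ru ut)).
have ti0 : 0 < t - start i by rewrite subr_gt0.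
have [q] : exists q : rat, ratr q \in `](s - start i) / (t - start i),
    (r - start i) / (t - start i)[.
  have : (s - start i) / (t - start i) < (r - start i) / (t - start i).
    by rewrite ltr_pM2r ?invr_gt0// ltrD2r.
  by move=> /rat_in_itvoo[q hq]; exists q.
rewrite in_itv/= ltr_pdivrMr// ltr_pdivlMr// ![_ * (t - _)]mulrC => /andP[q1 q2].
have sq : s <= itv_point (start i) t q by rewrite /itv_point; lra.
have qr : itv_point (start i) t q < r by rewrite /itv_point; lra.
have q0 : 0 <= ratr q :> R.
  have : 0 <= (t - start i) * ratr q by apply: le_trans (ltW q1); rewrite subr_ge0.
  by rewrite pmulr_rge0.
have q1' : ratr q <= 1 :> R.
  have : (t - start i) * ratr q <= t - start i.
    by apply: le_trans (ltW q2) _; rewrite lerD2r (le_trans ru).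
  by rewrite ger_pMr.
have [|[v vq /(fr v)]] := hall k ki q (conj q0 q1').
  by case; exists s.
by apply; exact: le_lt_trans qr.
Qed.

(** By induction on the index: the path is at its driving path if nothing has been
    hit, and at the path hit first otherwise. *)
Lemma path_adapted i t : start i <= t -> adapted t (B i t).
Proof.
elim/ltn_ind: i t => i IH t it.
pose G := g_sigma_algebraType (past t).
have mhits j s : (j < i)%N -> s <= t -> measurable (hits i j s : set G).
  move=> ji st; have sub : past s `<=` <<s past t >> by exact: past_subset.
  apply: (smallest_sub (smallest_sigma_algebra _ _) sub).
  by apply: measurable_hits => u ju us; apply: adaptedS us _; exact: IH.
move=> _ A mA; rewrite setTI.
pose none := ~` (\bigcup_(j in `I_i) hits i j t).
rewrite (_ : B i t @^-1` A = (none `&` (fun w => drive w i t) @^-1` A) `|`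
  \bigcup_(j in [set j | (j < i)%N /\ start j <= t])
     (hits_first i j t `&` B j t @^-1` A)).
  apply: (@measurableU _ G); [apply: (@measurableI _ G)|].
  - apply: (@measurableC _ G); apply: (@bigcup_measurable _ G) => j ji.
    exact: mhits.
  - by rewrite -[X in measurable X]setTI; exact: drive_adapted.
  - apply: (@bigcup_measurable _ G) => j [ji jt]; apply: (@measurableI _ G).
      apply: (@measurableI _ G); first exact: mhits.
      apply: (@bigcap_measurableType _ G) => l li.
      rewrite -[X in measurable X]setCK setC_bigcap; apply: (@measurableC _ G).
      rewrite bigcup_mkcond; apply: (@bigcupT_measurable_rat _ G) => q.
      case: ifP => [/[!inE] -[q0 q1]|_]; last exact: (@measurable0 _ G).
      have /andP[_ v2] := itv_point_le it q0 q1.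
      apply: (@measurableC _ G); apply: (@measurableU _ G); last exact: mhits.
      by apply: (@measurableC _ G); exact: mhits.
    by rewrite -[X in measurable X]setTI; exact: IH.
apply/seteqP; split=> w /=.
  have [h|nh] := pselect (exists j, hits i j t w).
    have [j ji hj] := hits_firstP it h.
    rewrite (hits_first_follow it hj) => Aw; right; exists j => //; split=> //.
    by have [[u ut [_ _ ju _]] _] := hj; exact: le_trans ut.
  move=> Aw; left; split; first by move=> [j _ hj]; apply: nh; exists j.
  rewrite -(eq_drive (HB w) it)// => j u ut mu; apply: nh; exists j.
  by exists u.
move=> [[nh Aw]|[j [ji jt] [hj Aw]]]; last by rewrite (hits_first_follow it hj).
rewrite (eq_drive (HB w) it)// => j u ut mu; apply: nh; exists j.
  by have [] := mu.
by exists u.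
Qed.

Lemma measurable_alive i t : start i <= t ->
  <<s past t >> [set w | alive pt (noise w) (path w) i t].
Proof.
move=> it; pose G := g_sigma_algebraType (past t).
rewrite (_ : [set w | _] = ~` (\bigcup_j hits i j t)).
  apply: (@measurableC _ G); apply: (@bigcup_measurable _ G) => j _.
  apply: measurable_hits => u ju ut; apply: adaptedS ut _; exact: path_adapted.
apply/seteqP; split=> w /=.
  by move=> a [j _ [u ut mu]]; exact: a ut mu.
by move=> na j u ut mu; apply: na; exists j => //; exists u.
Qed.

Lemma measurable_leader i t j : start i <= t ->
  <<s past t >> [set w | leader pt (noise w) (path w) i t = j].
Proof.
move=> it; pose G := g_sigma_algebraType (past t).
have [/andP[ji jt]|no] := boolP ((j <= i)%N && (start j <= t)); last first.
  rewrite (_ : [set w | _] = set0); first exact: (@measurable0 _ G).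
  apply/seteqP; split=> w //= e.
  have [] := leaderP (@Wc w) (HB w) it; rewrite e => h1 h2 _ _.
  by move: no; rewrite h1 h2.
rewrite (_ : [set w | _] = [set w | alive pt (noise w) (path w) j t] `&`
    (B j t \- B i t) @^-1` [set 0]).
  apply: (@measurableI _ G); first exact: measurable_alive.
  rewrite -[X in measurable X]setTI.
  have : adapted t (B j t \- B i t).
    by apply: measurable_funB; exact: path_adapted.
  by apply.
apply/seteqP; split=> w /=.
  move=> e; have [] := leaderP (@Wc w) (HB w) it; rewrite e => h1 h2 h3 ->.
  by rewrite subrr.
move=> [a /subr0_eq e]; apply: (leader_unique (HB w)).
by split.
Qed.

End adapted.

(** * How far a coalescing path travels in a short time *)

Section uniform_continuity.
Context {R : realType}.

Lemma segment_uniformly_continuous (f : R -> R) (a b e : R) :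
  continuous f -> 0 < e ->
  exists2 r, 0 < r & forall x y, x \in `[a, b] -> `|x - y| < r -> `|f x - f y| < e.
Proof.
move=> cf e0.
have := @segment_compact R a b.
move=> /compact_near_coveringP/(_ R 0^'+ (fun r x => forall y, `|x - y| < r ->
  `|f x - f y| < e)) cover.
have near_pos : \forall r \near (0 : R)^'+,
    `[a, b] `<=` (fun x => forall y, `|x - y| < r -> `|f x - f y| < e).
  apply: cover => x xab.
  have e2 : 0 < e / 2 by rewrite divr_gt0.
  have /cvgrPdist_lt /(_ _ e2) /nbhs_ballP[r /= r0 Hr] := cf x.
  have r2 : 0 < r / 2 by rewrite divr_gt0.
  exists (ball x (r / 2), [set s | s < r / 2]) => /=.
    split; first exact: nbhsx_ballx.
    by apply: nbhs_right_lt.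
  move=> [z s] /= [zx sr] y zy.
  have xz : `|f x - f z| < e / 2.
    by apply: Hr; rewrite /ball/=; move: zx; rewrite /ball/=; lra.
  have xy : `|f x - f y| < e / 2.
    apply: Hr; rewrite /ball/=; move: zx; rewrite /ball/= => zx.
    have -> : x - y = (x - z) + (z - y) by ring.
    by apply: le_lt_trans (ler_normD _ _) _; lra.
  have -> : f z - f y = (f x - f y) - (f x - f z) by ring.
  by apply: le_lt_trans (ler_normB _ _) _; lra.
have [r [r0 Hr]] := filter_ex (filterI (nbhs_right_gt (0 : R)) near_pos).
by exists r => // x y xab; exact: Hr.
Qed.

Lemma segment_equicontinuous (f : nat -> R -> R) n (a b e : R) :
  (forall i, continuous (f i)) -> 0 < e ->
  exists2 r, 0 < r & forall i x y, (i < n)%N -> x \in `[a, b] ->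
    `|x - y| < r -> `|f i x - f i y| < e.
Proof.
move=> cf e0; elim: n => [|n [r r0 IH]]; first by exists 1.
have [s s0 Hs] := segment_uniformly_continuous a b (cf n) e0.
exists (Num.min r s); first by rewrite lt_min r0 s0.
move=> i x y; rewrite ltnS leq_eqVlt lt_min => /predU1P[->|ni] xab /andP[xr xs].
  exact: Hs.
exact: IH.
Qed.

End uniform_continuity.

Section small_sets.
Context d (T : measurableType d) (R : realType) (P : probability T R).

(** An outer measure bound, for sets whose measurability would be tedious to
    establish. *)
Definition small (c : \bar R) (A : set T) :=
  exists E, [/\ measurable E, (P E <= c)%E & A `<=` E].

Lemma smallS c c' A B : A `<=` B -> (c <= c')%E -> small c B -> small c' A.
Proof.
move=> AB cc [E [mE PE BE]]; exists E; split=> //; first exact: le_trans cc.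
exact: subset_trans BE.
Qed.

Lemma smallU c c' A B : small c A -> small c' B -> small (c + c')%E (A `|` B).
Proof.
move=> [E [mE PE AE]] [F [mF PF BF]]; exists (E `|` F); split.
- exact: measurableU.
- by apply: le_trans (leeD PE PF); exact: measureU2.
- exact: setUSS.
Qed.

Lemma small_bigcup (c : R) (A : nat -> set T) n :
  (forall k, (k < n)%N -> small c%:E (A k)) ->
  small (c *+ n)%:E (\bigcup_(k in `I_n) A k).
Proof.
elim: n => [_|n IH sA].
  exists set0; split=> //; first by rewrite measure0.
  by move=> w [].
apply: (@smallS ((c *+ n)%:E + c%:E)%E _ _ ((\bigcup_(k in `I_n) A k) `|` A n)).
- move=> w [k /=]; rewrite ltnS leq_eqVlt => /predU1P[->|kn] Aw; first by right.
  by left; exists k.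
- by rewrite -EFinD mulrSr.
- by apply: smallU; [apply: IH => k kn; apply: sA; exact: ltnW|exact: sA].
Qed.

Lemma small_liminf (c : \bar R) (A : nat -> set T) :
  (forall n, small c (A n)) ->
  small c [set w | exists n0, forall n, (n0 <= n)%N -> A n w].
Proof.
move=> /choice[E HE].
have mE n : measurable (E n) by have [] := HE n.
pose G n := \bigcap_(k in [set k | (n <= k)%N]) E k.
have mG n : measurable (G n) by apply: bigcap_measurableType.
exists (\bigcup_n G n); split.
- exact: bigcup_measurable.
- have cvgG : P (G n) @[n --> \oo] --> P (\bigcup_n G n).
    apply: nondecreasing_cvg_mu => //; first exact: bigcup_measurable.
    move=> m n mn; apply/subsetPset => w Gw k /= nk.
    by apply: Gw; exact: leq_trans nk.
  rewrite -(cvg_lim _ cvgG)//; apply: lime_le; first by apply/cvg_ex; eexists; exact: cvgG.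
  apply: nearW => n; have [_ PE _] := HE n; apply: le_trans PE.
  apply: le_measure; rewrite ?inE//.
  by move=> w; apply; rewrite /= leqnn.
- move=> w [n0 An0]; exists n0 => // k kn.
  by have [_ _] := HE k; apply; exact: An0.
Qed.

Lemma small_negligible (A : set T) (c : nat -> R) :
  (forall n, small (c n)%:E A) -> c n @[n --> \oo] --> 0 -> P.-negligible A.
Proof.
move=> /choice[E HE] c0.
have mE n : measurable (E n) by have [] := HE n.
exists (\bigcap_n E n); split.
- exact: bigcap_measurableType.
- apply/eqP; rewrite eq_le measure_ge0 andbT.
  have c0' : (c n)%:E @[n --> \oo] --> 0%E by apply/fine_cvgP; split=> //; exact: nearW.
  rewrite -(cvg_lim _ c0')//; apply: lime_ge; first by apply/cvg_ex; eexists; exact: c0'.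
  apply: nearW => n; have [_ PE _] := HE n; apply: le_trans PE.
  apply: le_measure; rewrite ?inE//; first exact: bigcap_measurableType.
  by move=> w; exact.
- by move=> w Aw n _; have [_ _] := HE n; exact.
Qed.

End small_sets.

Section escape.
Context d (T : measurableType d) (R : realType) (P : probability T R)
  (X : nat -> R -> T -> R) (pt : nat -> R * R) (B : nat -> R -> T -> R).
Hypothesis HX : driving_noises P X.
Local Notation start i := (pt i).2.
Local Notation noise w := (fun l x => X l x w).
Local Notation path w := (fun l x => B l x w).
Local Notation drive w := (driving_path pt (noise w)).
Hypothesis HB : forall w, coalescing_system pt (noise w) (path w).

Let Wc w i : continuous (noise w i). Proof. exact: (noise_continuous HX). Qed.
Let W0 w i : noise w i 0 = 0. Proof. exact: (noise_frozen HX). Qed.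

Variables (i : nat) (tau : R).
Hypothesis tau0 : 0 < tau.

Definition mesh n k : R := start i + tau / 2 ^+ n * k%:R.

Let step_gt0 n : 0 < tau / 2 ^+ n.
Proof. by rewrite divr_gt0// exprn_gt0. Qed.

Lemma mesh_step n k : mesh n k.+1 - mesh n k = tau / 2 ^+ n.
Proof. by rewrite /mesh -natr1; ring. Qed.

Lemma mesh_nondecreasing n : {homo mesh n : k l / (k <= l)%N >-> k <= l}.
Proof. by move=> k l kl; rewrite lerD2l ler_pM2l// ler_nat. Qed.

Lemma mesh_ge n k : start i <= mesh n k.
Proof. by rewrite lerDl mulr_ge0// ltW. Qed.

(** The sign of [c] selects the direction in which the walk exceeds. *)
Lemma walk_exceeds n (c b : R) :
  small P (expR (- b + c ^+ 2 * tau / 2))%:E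
    [set w | exists2 k, (k <= 2 ^ n)%N &
       b <= c * leader_walk pt (noise w) (path w) i (mesh n) k].
Proof.
pose F k := past X (fun l => start l) (mesh n k).
pose L k w := leader pt (noise w) (path w) i (mesh n k).
pose D k j w := if start j <= mesh n k then
  c * (X j (mesh n k.+1 - start j) w - X j (mesh n k - start j) w) else 0.
pose C := expR (c ^+ 2 * (tau / 2 ^+ n) / 2).
have lt_mesh k : mesh n k < mesh n k.+1.
  by rewrite -subr_gt0 mesh_step.
have C1 : 1 <= C.
  by rewrite -[leLHS]expR0 ler_expR divr_ge0// mulr_ge0 ?sqr_ge0// ltW.
have FT k : F k `<=` measurable by exact: (past_measurable HX).
have FS k : F k `<=` <<s F k.+1 >> by apply: past_subset; exact: ltW.
have LN k w : (L k w < i.+1)%N.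
  by rewrite ltnS; apply: (leader_leq (@Wc w) (HB w)); exact: mesh_ge.
have mL k j : <<s F k >> (L k @^-1` [set j]).
  by apply: (measurable_leader HX HB); exact: mesh_ge.
have mD k j : measurable_fun setT (D k j : g_sigma_algebraType (F k.+1) -> R).
  have [jk|jk] := boolP (start j <= mesh n k); rewrite /D ?jk ?(negbTE jk);
    last exact: measurable_cst.
  apply: measurable_funM; first exact: measurable_cst.
  by apply: measurable_funB; apply: measurable_past; rewrite lerD2r// ltW.
have expD k j (Z : T -> \bar R) :
    measurable_fun setT (Z : g_sigma_algebraType (F k) -> \bar R) ->
    (forall w, 0 <= Z w)%E ->
    (\int[P]_w (Z w * (expR (D k j w))%:E) <= C%:E * \int[P]_w Z w)%E.
  move=> mZ Z0; have [jk|jk] := boolP (start j <= mesh n k); rewrite /D ?jk ?(negbTE jk).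
    have /= -> := @future_exponential_moment _ _ _ _ _ (fun l => start l) HX
      j (mesh n k) (mesh n k.+1) c Z jk (lt_mesh k) mZ Z0.
    by rewrite mesh_step.
  under eq_integral do rewrite expR0 mule1.
  by rewrite -[leLHS]mul1e lee_wpmul2r ?lee_fin//; exact: integral_ge0.
have [E mE [sub PE]] := chosen_walk_maximal b FT FS LN mL mD C1 expD (2 ^ n).
exists E; split=> //.
  apply: le_trans PE _; rewrite lee_fin expRD ler_wpM2l ?expR_ge0//.
  rewrite /C -expRM_natl ler_expR natrX le_eqVlt; apply/orP; left; apply/eqP.
  by field; rewrite expf_neq0.
move=> w [k kn bk]; apply: (sub w k kn); apply: le_trans bk _.
rewrite le_eqVlt; apply/orP; left; apply/eqP.
rewrite /chosen_walk; elim: k {kn} => [|k IH]; first by rewrite big_ord0 /= mulr0.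
rewrite big_ord_recr /= -IH mulrDr; congr (_ + _).
have [_ jk _ _] := leaderP (@Wc w) (HB w) (mesh_ge n k).
by rewrite /D jk /driving_path /L; ring.
Qed.

Definition escapes (delta : R) : set T := [set w | exists s,
  [/\ start i <= s, s <= start i + tau & delta < `|B i s w - (pt i).1|] ].

(** On a fine enough mesh, the walk of the leaders is uniformly close to the path,
    so that it makes half of the excursion. *)
Lemma escape_walk delta w : 0 < delta -> escapes delta w ->
  exists n0, forall n, (n0 <= n)%N -> exists2 k, (k <= 2 ^ n)%N &
    delta / 2 <= `|leader_walk pt (noise w) (path w) i (mesh n) k|.
Proof.
move=> d0 [s [ist sit ds]].
(* There are at most [2 * i + 1] errors of size [e], half of [delta] in total. *)
pose e := delta / (4 * i.+1%:R).
have e0 : 0 < e by rewrite divr_gt0// mulr_gt0.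
have [r1 r10 H1] := segment_uniformly_continuous (start i) (start i + tau)
  (@extended_path_continuous _ _ _ _ (@Wc w) (HB w) i) e0.
have [r2 r20 H2] := segment_equicontinuous i.+1 (start i) (start i + tau)
  (@drive_continuous _ pt _ (@Wc w)) e0.
pose r := Num.min r1 r2.
have r0 : 0 < r by rewrite lt_min r10 r20.
have [n0 n0P] : exists n0, forall n, (n0 <= n)%N -> tau / 2 ^+ n < r.
  exists (Num.truncn (tau / r)).+1 => n nn.
  rewrite ltr_pdivrMr ?exprn_gt0// mulrC -ltr_pdivrMr//.
  apply: lt_trans (truncnS_gt _) _.
  by rewrite -natrX ltr_nat; apply: leq_ltn_trans nn _; exact: ltn_expl.
exists n0 => n /n0P hn.
pose h := tau / 2 ^+ n; pose k := Num.truncn ((s - start i) / h).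
have h0 : 0 < h by exact: step_gt0.
have kle : k%:R <= (s - start i) / h.
  by rewrite truncn_le// divr_ge0 ?subr_ge0// ltW.
have klt : (s - start i) / h < k.+1%:R by exact: truncnS_gt.
have ks : mesh n k <= s.
  by rewrite /mesh -/h -lerBrDl mulrC -ler_pdivlMr.
have sk : s < mesh n k.+1.
  by rewrite /mesh -/h -ltrBlDl mulrC -ltr_pdivrMr.
have kn : (k <= 2 ^ n)%N.
  rewrite -(@ler_nat R); apply: le_trans kle _.
  rewrite ler_pdivrMr// /h natrX mulrC divfK ?expf_neq0//.
  by rewrite lerBlDl.
exists k => //.
have top m : (m <= 2 ^ n)%N -> mesh n m \in `[start i, start i + tau].
  move=> mn; rewrite in_itv/= mesh_ge /= lerD2l.
  by rewrite mulrAC ler_pdivrMr ?exprn_gt0// ler_pM2l// -natrX ler_nat.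
have stepr m : `|mesh n m - mesh n m.+1| < r.
  by rewrite distrC mesh_step gtr0_norm.
have BE u : start i <= u -> extended_path pt (path w) i u = B i u w.
  by move=> iu; rewrite extended_pathE.
have := @leader_walk_approx R pt (noise w) (path w) (@Wc w) (HB w) i (mesh n) k e
  (ltW e0) (mesh_ge n 0) (@mesh_nondecreasing n).
have -> : mesh n 0 = start i by rewrite /mesh mulr0 addr0.
rewrite (start_value (@Wc w) (@W0 w) (HB w)).
set M := leader_walk _ _ _ _ _ _.
move=> approx.
have {approx} approx : `|B i (mesh n k) w - (pt i).1 - M| <= e *+ (2 * i).
  apply: approx => [m mk|m j mk ji].
    rewrite -!BE ?mesh_ge// distrC ltW// H1 ?top ?(leq_trans (ltnW mk))//.
    by apply: lt_le_trans (stepr m) _; rewrite ge_min lexx.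
  rewrite distrC ltW// H2 ?top ?(leq_trans (ltnW mk))//.
  by apply: lt_le_trans (stepr m) _; rewrite ge_min lexx orbT.
have close : `|B i (mesh n k) w - B i s w| < e.
  rewrite -!BE ?mesh_ge// H1 ?top//.
  have kr : mesh n k.+1 - mesh n k < r1.
    by rewrite mesh_step; apply: lt_le_trans hn _; rewrite ge_min lexx.
  by rewrite distrC ger0_norm ?subr_ge0//; lra.
have e4 : e *+ (2 * i) + e <= delta / 2.
  have -> : e *+ (2 * i) + e = e * (2 * i%:R + 1) by rewrite -mulr_natr natrM; ring.
  rewrite /e mulrAC ler_pdivrMr ?mulr_gt0// -mulrA ler_pM2l// -[i.+1%:R]natr1.
  by have : (0 : R) <= i%:R by []; lra.
have tri : `|B i s w - (pt i).1| <= `|M| + (`|B i (mesh n k) w - (pt i).1 - M| +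
    `|B i (mesh n k) w - B i s w|).
  have -> : B i s w - (pt i).1 = M + ((B i (mesh n k) w - (pt i).1 - M) -
    (B i (mesh n k) w - B i s w)) by ring.
  by apply: le_trans (ler_normD _ _) _; rewrite lerD2l; exact: ler_normB.
lra.
Qed.

(** The bound for the walks does not depend on the mesh, hence passes to the inferior
    limit; it is optimal for the multiple [delta / (2 * tau)] of the walk. *)
Lemma escape_small delta : 0 < delta ->
  small P (2 * expR (- (delta ^+ 2 / (8 * tau))))%:E (escapes delta).
Proof.
move=> d0; pose c := delta / (2 * tau).
pose A n (a : R) := [set w | exists2 k, (k <= 2 ^ n)%N &
  c * (delta / 2) <= a * leader_walk pt (noise w) (path w) i (mesh n) k].
have c0 : 0 < c by rewrite divr_gt0// mulr_gt0.
have sA n a : a ^+ 2 = c ^+ 2 ->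
    small P (expR (- (delta ^+ 2 / (8 * tau))))%:E (A n a).
  move=> ac; apply: smallS (walk_exceeds n a (c * (delta / 2))); first by [].
  rewrite lee_fin ler_expR ac /c le_eqVlt; apply/orP; left; apply/eqP.
  by field; rewrite gt_eqF.
apply: (@smallS _ _ _ P (2 * expR (- (delta ^+ 2 / (8 * tau))))%:E _ _ _ _ (lexx _)
  (@small_liminf _ _ _ P _ (fun n => A n c `|` A n (- c)) _)); last first.
  by move=> n; rewrite mulr_natl mulr2n EFinD; apply: smallU; apply: sA => //; rewrite sqrrN.
move=> w /(escape_walk d0)[n0 hn0]; exists n0 => n /hn0[k kn].
rewrite ler_normr => /orP[h|h]; [left|right]; exists k => //.
  by rewrite ler_pM2l.
by rewrite mulNr -mulrN ler_pM2l.
Qed.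

End escape.

(** * Trapping web paths between skeleton paths *)

Section right_limits.
Context {R : realType}.

Lemma cvg_extends_continuously (s l : R) (g : R -> R) :
  g x @[x --> s^'+] --> l -> extends_continuously s g.
Proof.
move=> gl; exists (fun x => if s < x then g x else l); split.
  by move=> x ->.
rewrite ltxx; apply: cvg_trans gl; apply: near_eq_cvg.
near=> x; have -> // : s < x.
by near: x; exact: nbhs_right_gt.
Unshelve. all: by end_near. Qed.

Lemma right_limit_exists (s : R) (g : R -> R) :
  (forall e, 0 < e -> exists2 r, 0 < r & forall x y, s < x -> x <= y -> y < s + r ->
     `|g y - g x| <= e) ->
  cvg (g x @[x --> s^'+]).
Proof.
move=> osc; apply/cauchy_cvgP/cauchy_exP => e e0.
have e3 : 0 < e / 2 by rewrite divr_gt0.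
have [r r0 Hr] := osc _ e3.
exists (g (s + r / 2)).
have sr : s < s + r / 2 by rewrite ltrDl divr_gt0.
change (\forall x \near s^'+, ball (g (s + r / 2)) e (g x)); near=> x.
rewrite -ball_normE /=; apply: (@le_lt_trans _ _ (e / 2)); last by lra.
have sx : s < x by near: x; exact: nbhs_right_gt.
have xr : x < s + r / 2 by near: x; exact: nbhs_right_lt.
by apply: (Hr _ _ sx (ltW xr)); lra.
Unshelve. all: by end_near. Qed.

End right_limits.

Section traps.
Context (R : realType) (pt : nat -> R * R) (W B : nat -> R -> R).
Hypothesis Wc : forall i, continuous (W i).
Hypothesis HB : coalescing_system pt W B.
Variables (sigma : R) (g a : R -> R).
Hypothesis Hg : stable_web pt B sigma g a.

Local Notation pos i := (pt i).1.
Local Notation start i := (pt i).2.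

Definition confined i tau delta := forall s, start i <= s -> s <= start i + tau ->
  `|B i s - pos i| <= delta.

Lemma web_above i s u : sigma < s -> start i <= s -> B i s <= g s -> s <= u ->
  B i u <= g u.
Proof.
move=> ss si h su; have [j [js gj]] := Hg.2 s ss.
rewrite (gj u su).1; apply: (noncrossing Wc HB si js) => //.
by rewrite -(gj s (lexx s)).1.
Qed.

Lemma web_below i s u : sigma < s -> start i <= s -> g s <= B i s -> s <= u ->
  g u <= B i u.
Proof.
move=> ss si h su; have [j [js gj]] := Hg.2 s ss.
rewrite (gj u su).1; apply: (noncrossing Wc HB js si) => //.
by rewrite -(gj s (lexx s)).1.
Qed.

Lemma confined_below i tau delta s u : confined i tau delta -> sigma < s ->
  start i <= s -> s <= u -> u <= start i + tau -> pos i + delta <= g s ->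
  pos i - delta <= g u.
Proof.
move=> ci ss si su ut h.
have := ci s si (le_trans su ut); have := ci u (le_trans si su) ut.
rewrite !ler_distl => /andP[h1 _] /andP[_ h2].
by apply: le_trans h1 _; apply: (web_above ss si) => //; exact: le_trans h2 h.
Qed.

Lemma confined_above i tau delta s u : confined i tau delta -> sigma < s ->
  start i <= s -> s <= u -> u <= start i + tau -> g s <= pos i - delta ->
  g u <= pos i + delta.
Proof.
move=> ci ss si su ut h.
have := ci s si (le_trans su ut); have := ci u (le_trans si su) ut.
rewrite !ler_distl => /andP[_ h1] /andP[h2 _].
by apply: le_trans h1; apply: (web_below ss si) => //; exact: le_trans h h2.
Qed.

(** Barriers against paths coming from infinity. *)
Definition caged (q : R) := forall M : R,
  (exists i delta, [/\ start i = q, confined i 2 delta & M < pos i - delta]) /\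
  (exists i delta, [/\ start i = q, confined i 2 delta & pos i + delta < - M]).

(** Barriers at scale [delta]. The margin of [2] makes room for the grid lines
    around a path within distance [C] of the origin and for the grid time that
    precedes it. *)
Definition calm (C delta : R) := exists2 e, 0 < e <= 1 & forall j k : int,
  `|j%:~R * delta| <= C + 2 -> `|k%:~R * e| <= C + 2 ->
  exists2 i, pt i = (j%:~R * delta, k%:~R * e) & confined i (2 * e) delta.

(** A path arriving from infinity would have to cross a confined path that lies
    beyond its later position. *)
Lemma caged_bounded : (forall q : int, caged q%:~R) ->
  exists C, forall s, sigma < s -> s <= sigma + 1 -> `|g s| <= C.
Proof.
move=> cages; pose q := Num.floor sigma.
have /andP[q1 q2] := floor_itv sigma; rewrite intrD in q2.
have [[i [d [ti ci Mi]]] [j [e [tj cj Mj]]]] := cages q `|g (sigma + 1)|.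
exists (Num.max `|pos i + d| `|pos j - e|) => s ss s1.
have := ler_norm (g (sigma + 1)); have := ler_norm (- g (sigma + 1)).
rewrite normrN => n1 n2.
have hs : q%:~R <= s by apply: le_trans q1 (ltW ss).
have hu : sigma + 1 <= q%:~R + 2 by move: q2; rewrite /q; lra.
have gi : g s <= pos i + d.
  rewrite leNgt; apply/negP => h.
  have : pos i - d <= g (sigma + 1).
    apply: (@confined_below i 2 d s) => //; rewrite ?ti//; exact: ltW.
  lra.
have gj : pos j - e <= g s.
  rewrite leNgt; apply/negP => h.
  have : g (sigma + 1) <= pos j + e.
    apply: (@confined_above j 2 e s) => //; rewrite ?tj//; exact: ltW.
  lra.
rewrite ler_norml; apply/andP; split.
  rewrite lerNl le_max; apply/orP; right.
  have := ler_norm (- (pos j - e)); rewrite normrN; lra.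
rewrite le_max; apply/orP; left.
by have := ler_norm (pos i + d); lra.
Qed.

(** Over a time [e] the path stays between the two nearest grid paths that are at
    distance at least [delta] from it. *)
Lemma calm_oscillation (C delta : R) : 0 < delta <= 1 -> `|sigma| + 2 <= C ->
  calm C delta -> (forall s, sigma < s -> s <= sigma + 1 -> `|g s| <= C) ->
  exists2 r, 0 < r & forall s u, sigma < s -> s <= u -> u < sigma + r ->
    `|g u - g s| <= 3 * delta.
Proof.
move=> /andP[d0 d1] sC [e /andP[e0 e1] grid] bnd; exists e => // s u ss su ue.
have s1 : s <= sigma + 1 by lra.
have := bnd s ss s1; rewrite ler_norml => /andP[gC1 gC2].
pose k := Num.floor (s / e).
have /andP[k1 k2] := floor_itv (s / e); rewrite -/k in k1 k2.
rewrite ler_pdivlMr// in k1; rewrite ltr_pdivrMr// intrD mulrDl mul1r in k2.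
pose j := Num.floor (g s / delta).
have /andP[j1 j2] := floor_itv (g s / delta); rewrite -/j in j1 j2.
rewrite ler_pdivlMr// in j1; rewrite ltr_pdivrMr// intrD mulrDl mul1r in j2.
have [sb1 sb2] : - C <= sigma - 2 /\ sigma + 2 <= C.
  by have := ler_norm sigma; have := ler_norm (- sigma); rewrite normrN; split; lra.
have kC : `|k%:~R * e| <= C + 2 by rewrite ler_norml; apply/andP; split; lra.
have ejl : (j - 1)%:~R * delta = j%:~R * delta - delta by rewrite intrB; ring.
have ejr : (j + 2)%:~R * delta = j%:~R * delta + 2 * delta by rewrite intrD; ring.
have [||l El cl] := grid (j - 1) k => //.
  by rewrite ejl ler_norml; apply/andP; split; lra.
have [||r Er cr] := grid (j + 2) k => //.
  by rewrite ejr ler_norml; apply/andP; split; lra.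
have lo : pos l - delta <= g u.
  apply: (@confined_below l (2 * e) delta s) => //; rewrite El /= ?ejl; lra.
have hi : g u <= pos r + delta.
  apply: (@confined_above r (2 * e) delta s) => //; rewrite Er /= ?ejr; lra.
move: lo hi; rewrite El Er /= ejl ejr => lo hi.
by rewrite ler_norml; apply/andP; split; lra.
Qed.

Lemma trapped_cvg : (forall q : int, caged q%:~R) ->
  (forall C m : nat, calm C%:R (2 ^- m)) -> cvg (g x @[x --> sigma^'+]).
Proof.
move=> /caged_bounded[C0 bnd] calms; apply: right_limit_exists => e e0.
pose C := Num.truncn (Num.max C0 (`|sigma| + 2)).
pose m := Num.truncn (3 / e).
have hC : Num.max C0 (`|sigma| + 2) < C.+1%:R by exact: truncnS_gt.
have hm : 3 / e < m.+1%:R by exact: truncnS_gt.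
have m2 : 3 * 2 ^- m.+1 <= e.
  rewrite ler_pdivrMr ?exprn_gt0// mulrC -ler_pdivrMr//.
  apply: le_trans (ltW hm) _; rewrite -natrX ler_nat.
  exact: ltnW (ltn_expl _ _).
have [|||r r0 Hr] := @calm_oscillation C.+1%:R (2 ^- m.+1) _ _ (calms _ _).
- by rewrite invr_gt0 exprn_gt0//= invf_le1 ?exprn_gt0// exprn_ege1// ler1n.
- by apply: le_trans (ltW hC); rewrite le_max lexx orbT.
- move=> s s1 s2; apply: le_trans (bnd s s1 s2) _.
  by apply: le_trans (ltW hC); rewrite le_max lexx.
by exists r => // x y sx xy yr; apply: le_trans m2; exact: Hr.
Qed.

End traps.

(** * Traps exist almost surely *)

Section almost_sure_traps.
Context d (T : measurableType d) (R : realType) (P : probability T R)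
  (X : nat -> R -> T -> R) (pt : nat -> R * R) (B : nat -> R -> T -> R).
Hypothesis HX : driving_noises P X.
Local Notation noise w := (fun l x => X l x w).
Local Notation path w := (fun l x => B l x w).
Hypothesis HB : forall w, coalescing_system pt (noise w) (path w).
Hypothesis Hpt : forall x t : R, dyadic x -> dyadic t -> exists i, pt i = (x, t).

Lemma dyadicP (j : int) n : dyadic (j%:~R * 2 ^- n : R).
Proof. by exists j, n. Qed.

Lemma dyadic_int (j : int) : dyadic (j%:~R : R).
Proof. by exists j, 0%N; rewrite expr0 divr1. Qed.

Lemma not_escapes_confined i tau delta w : ~ escapes pt B i tau delta w ->
  confined pt (path w) i tau delta.
Proof.
by move=> ne s h1 h2; rewrite leNgt; apply/negP => h; apply: ne; exists s.
Qed.

(** Paths started at the integers [s * (j + 1)] escape to distance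
    [(j + 1) / 2] with a probability vanishing as [j] grows, so almost surely
    infinitely many of them do not. *)
Lemma confined_infinitely_often (q s : int) : P.-negligible [set w |
  ~ forall j0, exists j i, [/\ (j0 <= j)%N, pt i = ((s * j.+1%:Z)%:~R, q%:~R) &
    confined pt (path w) i 2 (j.+1%:R / 2)] ].
Proof.
have /choice[idx idxP] : forall j : nat, exists i,
    pt i = ((s * j.+1%:Z)%:~R, q%:~R).
  by move=> j; apply: Hpt; exact: dyadic_int.
pose c (M : nat) : R := 128 * M.+1%:R^-1.
apply: (@small_negligible _ _ _ P _ c); last first.
  rewrite -[X in _ --> X](mulr0 128); apply: cvgM; first exact: cvg_cst.
  exact: cvg_harmonic.
move=> M.
pose A j := escapes pt B (idx (j + M)%N) 2 ((j + M).+1%:R / 2).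
apply: (@smallS _ _ _ P (c M)%:E _ _ [set w | exists j0, forall j, (j0 <= j)%N -> A j w])
  => //.
  move=> w nconf; apply: contrapT => nA; apply: nconf => j0.
  have [j jj0 nAj] : exists2 j, (j0 <= j)%N & ~ A j w.
    apply: contrapT => h; apply: nA; exists j0 => j jj0.
    by apply: contrapT => nAj; apply: h; exists j.
  exists (j + M)%N, (idx (j + M)%N); split=> //.
    by rewrite (leq_trans jj0)// leq_addr.
  exact: not_escapes_confined.
apply: small_liminf => j.
have half0 : 0 < (j + M).+1%:R / 2 :> R by rewrite divr_gt0.
apply: smallS (escape_small HX HB (idx (j + M)%N) (ltr0Sn R 1) half0); first by [].
rewrite lee_fin /c.
set y : R := (j + M).+1%:R.
have y1 : 1 <= y by rewrite ler1n.
have yM : M.+1%:R <= y by rewrite ler_nat ltnS leq_addl.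
have M0 : 0 < M.+1%:R :> R by [].
rewrite expRN; set x := (y / 2) ^+ 2 / (8 * 2).
have hx : y / 64 <= expR x.
  apply: le_trans (expR_ge1Dx x); apply: le_trans (_ : x <= _); last by rewrite lerDr.
  by rewrite /x; nra.
have -> : 128 / M.+1%:R = 2 * (M.+1%:R / 64)^-1 :> R by rewrite invf_div; field; rewrite gt_eqF.
rewrite ler_pM2l// lef_pV2 ?posrE ?expR_gt0 ?divr_gt0//.
by apply: le_trans hx; rewrite ler_pM2r.
Qed.

Lemma caged_ae (q : int) :
  P.-negligible [set w | ~ caged pt (path w) q%:~R].
Proof.
have N1 := confined_infinitely_often q 1.
have N2 := confined_infinitely_often q (- 1).
apply: negligibleS (negligibleU N1 N2) => w /= nc.
apply: contrapT => /not_orP[/contrapT h1 /contrapT h2]; apply: nc => M.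
have hM j : (Num.truncn (2 * M) <= j)%N -> M < j.+1%:R / 2 :> R.
  move=> Mj; have : 2 * M < (Num.truncn (2 * M)).+1%:R by exact: truncnS_gt.
  move: Mj; rewrite -ltnS -(@ler_nat R); lra.
split.
  have [j [i [Mj ei ci]]] := h1 (Num.truncn (2 * M)).
  exists i, (j.+1%:R / 2); rewrite ei /=; split=> //.
  have := hM j Mj; rewrite mul1r -pmulrn; lra.
have [j [i [Mj ei ci]]] := h2 (Num.truncn (2 * M)).
exists i, (j.+1%:R / 2); rewrite ei /=; split=> //.
have := hM j Mj; rewrite mulN1r intrN -pmulrn; lra.
Qed.

(** At time scale [2 ^- n] the box contains of order [2 ^ n] grid paths, each of
    which escapes with a probability at most of order [4 ^- n]. *)
Lemma calm_ae (C m : nat) :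
  P.-negligible [set w | ~ calm pt (path w) C%:R (2 ^- m)].
Proof.
pose J := ((C + 2) * 2 ^ m)%N; pose K n := ((C + 2) * 2 ^ n)%N.
pose delta : R := 2 ^- m.
have d0 : 0 < delta by rewrite invr_gt0 exprn_gt0.
have /choice[idx idxP] : forall nab : nat * nat * nat, exists i, pt i =
    ((nab.1.2%:Z - J%:Z)%:~R * 2 ^- m, (nab.2%:Z - (K nab.1.1)%:Z)%:~R * 2 ^- nab.1.1).
  by move=> nab; apply: Hpt; exact: dyadicP.
pose bad n := \bigcup_(a in `I_(2 * J).+1) \bigcup_(b in `I_(2 * K n).+1)
  escapes pt B (idx (n, a, b)) (2 * 2 ^- n) delta.
have nat_of_int (r : nat) (x : R) (l : nat) (j : int) : x = 2 ^- l ->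
    `|j%:~R * x| <= r%:R -> exists2 a, (a < (2 * (r * 2 ^ l)).+1)%N &
    j = a%:Z - (r * 2 ^ l)%N%:Z.
  move=> -> h; have : `|j| <= (r * 2 ^ l)%N%:Z.
    rewrite -(ler_int R) intr_norm -[X in _ <= X]pmulrn natrM natrX.
    by move: h; rewrite normrM [`|2 ^- l|]ger0_norm ?invr_ge0 ?exprn_ge0// ler_pdivrMr ?exprn_gt0.
  move=> jl; exists (absz (j + (r * 2 ^ l)%N%:Z)); lia.
have sub n : [set w | ~ calm pt (path w) C%:R delta] `<=` bad n.
  move=> w nc; apply: contrapT => nbad; apply: nc.
  exists (2 ^- n).
    by rewrite invr_gt0 exprn_gt0//= invf_le1 ?exprn_gt0// exprn_ege1// ler1n.
  rewrite -natrD => j k hj hk.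
  have [a aJ ej] := nat_of_int (C + 2)%N delta m j erefl hj.
  have [b bK ek] := nat_of_int (C + 2)%N (2 ^- n) n k erefl hk.
  exists (idx (n, a, b)); first by rewrite idxP /= ej ek.
  apply: not_escapes_confined => esc; apply: nbad.
  by exists a => //; exists b.
pose D : R := 1024 / delta ^+ 4 * (2 * C + 5)%:R * (2 * J).+1%:R.
apply: (@small_negligible _ _ _ P _ (geometric D (2^-1))); last first.
  by apply: cvg_geometric; rewrite gtr0_norm// invf_lt1// ltr1n.
move=> n.
pose c : R := 2 * expR (- (delta ^+ 2 / (8 * (2 * 2 ^- n)))).
apply: (@smallS _ _ _ P ((c *+ (2 * K n).+1) *+ (2 * J).+1)%:E _ _ (bad n)) => //.
  rewrite lee_fin -[leLHS]mulr_natr -[c *+ _]mulr_natr.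
  rewrite -[leRHS]/(D * 2^-1 ^+ n) /c.
  set x := delta ^+ 2 / _.
  have x0 : 0 < x by rewrite divr_gt0 ?exprn_gt0// !mulr_gt0// invr_gt0 exprn_gt0.
  have ex : expR (- x) <= 2 / x ^+ 2.
    rewrite expRN -[leRHS]invrK invf_div lef_pV2 ?posrE ?expR_gt0 ?divr_gt0 ?exprn_gt0//.
    by apply: le_trans (expR_ge1Dxn 1 (ltW x0)); rewrite /= lerDr.
  have pn0 : 0 < 2 ^+ n :> R by rewrite exprn_gt0.
  have Kn : (2 * K n).+1%:R <= (2 * C + 5)%:R * 2 ^+ n :> R.
    rewrite -natrX -natrM ler_nat /K.
    have : (0 < 2 ^ n)%N by rewrite expn_gt0.
    nia.
  have -> : D * 2^-1 ^+ n = 2 * (2 / x ^+ 2) * ((2 * C + 5)%:R * 2 ^+ n) * (2 * J).+1%:R.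
    rewrite /D /x exprVn; field.
    by rewrite !gt_eqF.
  by rewrite ler_pM2r//; apply: ler_pM; rewrite ?mulr_ge0 ?expR_ge0 ?ler_pM2l.
apply: small_bigcup => a _; apply: small_bigcup => b _.
by apply: (escape_small HX HB).
Qed.

Lemma web_right_limits : P.-negligible [set w | ~ forall sigma g a,
  stable_web pt (path w) sigma g a -> cvg (g x @[x --> sigma^'+])].
Proof.
have N1 : P.-negligible (\bigcup_n [set w | exists q : int,
    unpickle n = Some q /\ ~ caged pt (path w) q%:~R]).
  apply: negligible_bigcup => n.
  case e : (@unpickle int n) => [q|].
    by apply: negligibleS (caged_ae q) => w [q' [[->]]].
  by apply: negligibleS (negligible_set0 _) => w [q' []].
have N2 : P.-negligible (\bigcup_C \bigcup_m
    [set w | ~ calm pt (path w) C%:R (2 ^- m)]).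
  by do 2 apply: negligible_bigcup => ?; exact: calm_ae.
apply: negligibleS (negligibleU N1 N2) => w /= nc.
apply: contrapT => /not_orP[h1 h2]; apply: nc => sigma g a Hg.
apply: (trapped_cvg _ (HB w) Hg).
- by move=> i; exact: (noise_continuous HX).
- move=> q; apply: contrapT => nq; apply: h1; exists (pickle q) => //.
  by exists q; rewrite pickleK.
- by move=> C m; apply: contrapT => nq; apply: h2; exists C => //; exists m.
Qed.

End almost_sure_traps.

(** * From almost sure to sure path properties *)

Section normalisation.
Context d (T : measurableType d) (R : realType) (P : probability T R).

Lemma coalescing_system_eq (pt : nat -> R * R) (W W' B : nat -> R -> R) :
  (forall i s, 0 <= s -> W' i s = W i s) ->
  coalescing_system pt W B -> coalescing_system pt W' B.
Proof.
move=> WW HB.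
have dE i s : (pt i).2 <= s -> driving_path pt W' i s = driving_path pt W i s.
  by move=> is_; rewrite /driving_path WW// subr_ge0.
have mE i j s : Defs.meets pt W' B i j s <-> Defs.meets pt W B i j s.
  by split=> -[ji h1 h2 e]; split=> //; rewrite -e dE.
move=> i s h; have [h1 h2] := HB i s h; split.
  by move=> nm; rewrite dE// h1// => j u us /mE; exact: nm.
move=> j u us /mE mu nm; apply: (h2 j u us mu) => k v vu /mE.
exact: nm vu.
Qed.

Lemma continuous_frozen (f : R -> R) : {within `[0, +oo[, continuous f} ->
  continuous (fun t : R => f (Num.max t 0)).
Proof.
move=> /subspace_continuousP cf x.
have x0 : `[0, +oo[%classic (Num.max x 0) by rewrite /= in_itv/= le_max lexx orbT.
apply: (@cvg_comp _ _ _ (fun t : R => Num.max t 0) f _ _ _ _ (cf _ x0)).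
have cmax : continuous (fun t : R => Num.max t 0).
  by move=> s; apply: continuous_max; [exact: cvg_id|exact: cvg_cst].
move=> U; rewrite /within /= => nU.
have near_x : \forall z \near x, [set` `[0, +oo[] (Num.max z 0 : R) -> U (Num.max z 0).
  exact: (cmax x _ nU).
change (\forall z \near x, U (Num.max z 0)); apply: filterS near_x => z; apply.
by rewrite /= in_itv/= le_max lexx orbT.
Qed.

(** Precomposing with a measure-preserving map into the event where the sample
    paths are regular makes their properties hold everywhere while keeping all
    the laws. *)
Lemma frozen_driving_noises (W : nat -> R -> {RV P >-> R}) (rho : T -> T) :
  independent_brownian_motions W -> measurable_fun setT rho ->
  (forall E, measurable E -> P (rho @^-1` E) = P E) ->
  (forall l w, W l 0 (rho w) = 0) ->
  (forall l w, {within `[0, +oo[, continuous (fun t => W l t (rho w))}) ->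
  driving_noises P (fun l x w => W l (Num.max x 0) (rho w)).
Proof.
move=> [BM indep] mrho Prho W0 Wc; split.
- by move=> l x w x0; rewrite max_r.
- by move=> l w; apply: (continuous_frozen (Wc l w)).
- by move=> l x; apply: measurableT_comp.
- move=> l s t s0 st A mA; rewrite !max_l//; last exact: le_trans (ltW st).
  have [_ law _ _] := BM l; rewrite -(law s t s0 st A mA).
  rewrite -(Prho ((fun w => W l t w - W l s w) @^-1` A))//.
  rewrite -[X in measurable X]setTI; apply: measurable_funB => //.
- move=> N K u A u0 uS mA.
  have upos l k : Num.max (u l k) 0 = u l k.
    by rewrite max_l//; apply: le_trans (u0 l) _; exact: uS.
  pose inc l k w := W l (u l k.+1) w - W l (u l k) w.
  have minc l k : measurable_fun setT (inc l k) by exact: measurable_funB.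
  have mincA l k : measurable (inc l k @^-1` A l k).
    by rewrite -[X in measurable X]setTI; exact: minc.
  pose E l := \bigcap_(k in [set` iota 0 K]) (inc l k @^-1` A l k).
  have mE l : measurable (E l) by exact: bigcap_measurableType.
  transitivity (P (\bigcap_(l in [set` iota 0 N]) E l)).
    rewrite -[RHS]Prho; last exact: bigcap_measurableType.
    congr (P _); apply/seteqP; split=> w /=.
      move=> h l; rewrite /= mem_iota add0n => lN k; rewrite /= mem_iota add0n => kK.
      by have := h l k lN kK; rewrite !upos.
    move=> h l k lN kK; rewrite !upos; apply: (h l _ k) => /=.
      by rewrite mem_iota.
    by rewrite mem_iota.
  rewrite indep ?iota_uniq//; last first.
    move=> l _; pose G := \bigcup_(t in `[0, +oo[) sigma_of (W l t : T -> R).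
    have mW k : measurable_fun setT (W l (u l k) : g_sigma_algebraType G -> R).
      move=> _ Y mY; apply: sub_sigma_algebra; exists (u l k).
        by rewrite /= in_itv/= andbT -upos le_max lexx orbT.
      by exists Y.
    rewrite /sigma_of_process -/G.
    apply: (@bigcap_measurableType _ (g_sigma_algebraType G)) => k _.
    rewrite -[X in measurable X]setTI.
    have : measurable_fun setT (inc l k : g_sigma_algebraType G -> R).
      exact: measurable_funB.
    by apply.
  rewrite -[in LHS](subn0 N) (big_mkord xpredT); apply: eq_bigr => l _.
  have [_ _ incr _] := BM l.
  rewrite [LHS](incr (u l) (u0 l) (uS l) (iota 0 K)) ?iota_uniq//; last first.
    by move=> k _; exists (A l k); rewrite ?setTI.
  rewrite -[in LHS](subn0 K) (big_mkord xpredT); apply: eq_bigr => k _.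
  rewrite -[LHS]Prho//; congr (P _).
  by apply/seteqP; split=> w; rewrite /= !upos.
Qed.

End normalisation.

Unset Implicit Arguments.

Theorem proposition4p1 (R : realType) (d : measure_display)
    (T : measurableType d) (P : probability T R)
    (pt : nat -> R * R) (W : nat -> R -> {RV P >-> R}) (B : nat -> R -> T -> R)
    (hpt : dyadic_enumeration pt)
    (hW : independent_brownian_motions W)
    (hB : {ae P, forall w,
      coalescing_system pt (fun i t => W i t w) (fun i t => B i t w)}) :
  {ae P, forall w, forall (sigma : R) (g a : R -> R),
    stable_web pt (fun i t => B i t w) sigma g a ->
    cvg (g x @[x --> sigma^'+]) /\
    extends_continuously sigma g /\ extends_continuously sigma a}.
Proof.
have [BM _] := hW.
have regular : {ae P, forall w, [/\ coalescing_system pt (fun i t => W i t w)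
    (fun i t => B i t w), forall i, W i 0 w = 0 &
    forall i, {within `[0, +oo[, continuous (fun t => W i t w)}]}.
  have ae0 : {ae P, forall w, forall i, W i 0 w = 0}.
    by apply/ae_foralln => i; have [] := BM i.
  have aec : {ae P, forall w, forall i, {within `[0, +oo[, continuous (fun t => W i t w)}}.
    by apply/ae_foralln => i; have [] := BM i.
  by move: hB ae0 aec; apply: filterS3 => w h1 h2 h3; split.
have [N [mN PN subN]] := regular.
have reg w : ~ N w -> [/\ coalescing_system pt (fun i t => W i t w)
    (fun i t => B i t w), forall i, W i 0 w = 0 &
    forall i, {within `[0, +oo[, continuous (fun t => W i t w)}].
  by move=> Nw; apply: contrapT => h; apply: Nw; exact: subN.
have [w0 Nw0] : exists w0, ~ N w0.
  apply: contrapT => h; have : P N = 1%E.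
    rewrite (_ : N = setT) ?probability_setT//; apply/seteqP; split=> // w _.
    by apply: contrapT => Nw; apply: h; exists w.
  by rewrite PN => /eqP; rewrite eq_sym onee_eq0.
(* All exceptional outcomes are redirected to one regular outcome. *)
pose rho w := if w \in N then w0 else w.
have rhoN w : ~ N (rho w).
  by rewrite /rho; case: ifPn => // /negP; rewrite inE.
have rhoid w : ~ N w -> rho w = w by move=> Nw; rewrite /rho memNset.
have mrho : measurable_fun setT rho.
  apply: measurable_fun_ifT => //; apply: (@measurable_fun_bool _ _ _ _ true).
  rewrite setTI (_ : _ @^-1` _ = N)//.
  by apply/seteqP; split=> w /= => [/set_mem|/mem_set].
have Prho E : measurable E -> P (rho @^-1` E) = P E.
  move=> mE.
  have mpre : measurable (rho @^-1` E).
    by rewrite -[X in measurable X]setTI; exact: mrho.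
  have off A : measurable A -> P A = P (A `\` N).
    move=> mA; rewrite (measureDI P mA mN) [X in (_ + X)%E](_ : _ = 0%E) ?adde0//.
    by apply/eqP; rewrite -measure_le0 -PN le_measure ?inE//; exact: measurableI.
  rewrite off// [RHS]off//; congr (P _).
  by apply/seteqP; split=> w /= [Ew Nw]; split=> //; move: Ew; rewrite rhoid.
pose X l x w := W l (Num.max x 0) (rho w).
have HX : driving_noises P X.
  apply: frozen_driving_noises => //.
  - by move=> l w; have [_ h _] := reg _ (rhoN w).
  - by move=> l w; have [_ _ h] := reg _ (rhoN w).
have HB w : coalescing_system pt (fun l x => X l x w) (fun l x => B l x (rho w)).
  have [h _ _] := reg _ (rhoN w).
  by apply: coalescing_system_eq h => i s s0; rewrite /X max_l.
have Hpt x t : dyadic x -> dyadic t -> exists i, pt i = (x, t).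
  by move=> dx dt; have [_ _ sur] := hpt; have [i _ <-] := sur (x, t) (conj dx dt); exists i.
have limits := @web_right_limits d T R P X pt (fun l x w => B l x (rho w)) HX HB Hpt.
have nullN : P.-negligible N by apply/negligibleP.
apply: negligibleS (negligibleU limits nullN) => w /= nc.
apply: contrapT => /not_orP[/contrapT lim Nw]; apply: nc => sigma g a Hg.
rewrite (rhoid w Nw) in lim.
have cg := lim sigma g a Hg.
have [[_ a0 _ _] _] := Hg.
split=> //; split; last exact: cvg_extends_continuously a0.
by have /cvg_ex[l gl] := cg; exact: cvg_extends_continuously gl.
Qed.
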